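(* Let $(\mu,\nu)$ be any valid pair and let $v\ge 0$. If $v$ is slow, then almost surely $PS_{>v}$ is infinite. If $v$ is fast, then almost surely $PS_{>v}$ is finite.
   Context: Bullet process. Let $\mu$ (velocity distribution) and $\nu$ (delay distribution) be probability measures on $(0,\infty)$, and let $(v_i,\Delta_i)_{i\ge 0}$ be i.i.d. with law $\mu\otimes\nu$. Bullet $b_i=(i,v_i,\Delta_i)$ has index $i$, velocity $v_i$ and delay $\Delta_i$. Given bullets $(b_i)_{i\in J}$ indexed by a finite or infinite set $J=\{m,m+1,\dots\}$ of consecutive nonnegative integers, the bullet process on them is defined as follows: $b_i$ is fired from the origin at time $t_i=\sum_{m<j\le i}\Delta_j$ (so the first bullet is fired at time $0$) and its trajectory is $d_t(i)=v_i(t-t_i)$ for $t\ge t_i$. It becomes active at time $t_i$ and remains active until the first time, if ever, it collides with (is at the same position as) another active bullet; colliding bullets annihilate and are inactive at all later times. A bullet perishes in the process if it is annihilated, and otherwise survives in it. The pair $(\mu,\nu)$ is valid if almost surely no three bullets collide simultaneously. This is assumed throughout. Let $b_0^v=(0,v,\Delta_0)$ for $v\ge 0$ (velocity $0$ is allowed here), and let $\theta(v)$ be the probability that $b_0^v$ survives in the process on $(b_0^v,b_1,b_2,\dots)$. The speed $v$ is called fast if $\theta(v)>0$ and slow if $\theta(v)=0$. Bullet $b_n$ is a potential survivor if it survives in the process on $(b_0,\dots,b_n)$. $PS$ is the (random) set of potential survivors, and $PS_{>v}=\{b_i\in PS: v_i>v\}$. *)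

(* Defs.v *)
From HB Require Import structures.
From mathcomp Require Import all_boot all_order all_algebra.
From mathcomp Require Import all_classical all_reals all_analysis.

Set Implicit Arguments.
Unset Strict Implicit.
Unset Printing Implicit Defensive.

Import Order.TTheory GRing.Theory Num.Theory.
Import numFieldNormedType.Exports.

Local Open Scope classical_set_scope.
Local Open Scope ring_scope.

(* A configuration of bullets is a sequence [b : nat -> R * R], where
   [b i = (velocity, delay)] of the bullet of index [i].  A process runs on the
   bullets whose index lies in [J : set nat], [J] being a finite or infinite
   interval of integers with least element [m]. *)
Section BulletProcess.
Variable R : realType.
Implicit Types (b : nat -> R * R) (m n i j k : nat) (J : set nat) (s t : R).

Definition velocity b i : R := (b i).1.
Definition delay b i : R := (b i).2.

Definition fire_time b m i : R := \sum_(m.+1 <= j < i.+1) delay b j.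

(* Only meaningful for [fire_time b m i <= t]. *)
Definition position b m i t : R := velocity b i * (t - fire_time b m i).

(* [A t] is the set of bullets that are active at time [t]. *)
Definition collide b m (A : R -> set nat) t i j : Prop :=
  [/\ i != j, A t i, A t j & position b m i t = position b m j t].

(* A bullet counts as active at the very instant at which it collides, and as
   inactive at all strictly later times; thus every bullet taking part in a
   collision (of two or more bullets) is annihilated by it.  When the delays
   and the velocities are positive (the first velocity may be 0) and finitely
   many bullets are fired before any given time, which is almost surely the
   case for the random bullets considered below, the evolution [A] exists and
   is unique: up to a given time only finitely many pairs of trajectories can
   meet, each pair at most once, so [A] is determined meeting by meeting. *)
Definition is_evolution b m J (A : R -> set nat) : Prop :=
  forall t i, A t i <->
    [/\ J i, fire_time b m i <= t & forall s j, s < t -> ~ collide b m A s i j].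

Definition perishes_in b m (A : R -> set nat) i : Prop :=
  exists t j, collide b m A t i j.

Definition survives b m J i : Prop :=
  exists A, [/\ is_evolution b m J A, J i & ~ perishes_in b m A i].

Definition bullets_from m : set nat := [set i | (m <= i)%N].
Definition bullets_between m n : set nat := [set i | (m <= i <= n)%N].

Definition no_triple_collision b m J : Prop :=
  forall A, is_evolution b m J A ->
  ~ exists t i j k, [/\ collide b m A t i j, collide b m A t i k & j != k].

(* The sequence (b_0^v, b_1, b_2, ...): [b_0] keeps its delay. *)
Definition with_first_speed b (v : R) : nat -> R * R :=
  fun i => if i == 0%N then (v, delay b 0) else b i.

Definition PS b : set nat :=
  [set n | survives b 0 (bullets_between 0 n) n].

Definition PS_above b (v : R) : set nat :=
  [set n | PS b n /\ v < velocity b n].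

End BulletProcess.

Section RandomBullets.
Context {d : measure_display} {T : measurableType d} {R : realType}.
Variable P : probability T R.

Definition mutually_independent {d' : measure_display} {S : measurableType d'}
    (X : nat -> {RV P >-> S}) : Prop :=
  forall (I : seq nat) (E : nat -> set S),
    uniq I -> (forall i, measurable (E i)) ->
    P (\bigcap_(i in [set` I]) X i @^-1` E i) =
    (\prod_(i <- I) P (X i @^-1` E i))%E.

Definition iid_bullets (mu nu : probability (measurableTypeR R) R)
    (b : nat -> {RV P >-> (measurableTypeR R * measurableTypeR R)%type}) : Prop :=
  mutually_independent b /\
  forall i E, measurable E -> distribution P (b i) E = (mu \x nu)%E E.

Definition config {d' : measure_display} {S : measurableType d'}
    (b : nat -> {RV P >-> S}) (w : T) : nat -> S := fun i => b i w.

(* For i.i.d. bullets of law mu (x) nu this depends on (mu, nu) only. *)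
Definition valid
    (b : nat -> {RV P >-> (measurableTypeR R * measurableTypeR R)%type}) : Prop :=
  {ae P, forall w, no_triple_collision (config b w) 0 (bullets_from 0)}.

(* [mu_ext P] is the outer probability of [P].  It coincides with [P] on
   measurable events and with the completion of [P] on events that are
   measurable up to a null set, whereas [P] itself is unconstrained outside the
   sigma-algebra.  It is used because the survival event is only controlled on
   the almost sure event on which the evolution is well defined. *)
Definition theta
    (b : nat -> {RV P >-> (measurableTypeR R * measurableTypeR R)%type})
    (v : R) : \bar R :=
  mu_ext P [set w | survives (with_first_speed (config b w) v) 0
                      (bullets_from 0) 0].

Definition fast
    (b : nat -> {RV P >-> (measurableTypeR R * measurableTypeR R)%type})
    (v : R) : Prop := (0 < theta b v)%E.

Definition slow
    (b : nat -> {RV P >-> (measurableTypeR R * measurableTypeR R)%type})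
    (v : R) : Prop := theta b v = 0%E.

End RandomBullets.

(* Main.v *)
(** Write A_k for the event that the process on b_{k+1}, b_{k+2}, ... never
    reaches the line of speed v leaving the origin at time t_k; then
    P(A_k) = theta(v), and A_k is independent of b_0, ..., b_k.

    Fast speeds.  If k < l are potential survivors faster than v and A_k and A_l
    both hold, then b_l survives for ever in the process on b_{k+1}, b_{k+2}, ...
    and so reaches the line of A_k, a contradiction.  Hence
    sum_k P(k in PS_{>v}) theta(v) <= 1, and Borel-Cantelli applies.

    Slow speeds.  Suppose that PS_{>v} is finite with positive probability.  A
    bullet surviving for ever has a fast speed, so the first half of the proof
    allows one to discard everything up to the last survivor faster than v: with
    positive probability, PS_{>v} is finite and no bullet faster than v survives
    the infinite process.
    If mu(]0, v]) = 0, then b_0, ..., b_n annihilate completely for all large n,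
    in particular for some even n; so there is a triple collision, and slower
    bullets fired next leave it undisturbed, contradicting validity.
    If mu(]0, v]) > 0, put in front of such a process many pairs of a bullet
    slower than v followed by one that the process cannot catch: the pairs
    annihilate, and their delays give a bullet of speed v fired before them so
    large a lead that it survives.  Hence theta(v) > 0. *)

Require Import Defs.
From HB Require Import structures.
From mathcomp Require Import all_boot all_order all_algebra.
From mathcomp Require Import all_classical all_reals all_analysis.
From mathcomp Require Import measurable_realfun.
From mathcomp Require Import ring lra zify.

Set Implicit Arguments.
Unset Strict Implicit.
Unset Printing Implicit Defensive.

Import Order.TTheory GRing.Theory Num.Theory.
Import numFieldNormedType.Exports.

Local Open Scope classical_set_scope.
Local Open Scope ring_scope.

(** * Evolutions of finitely or infinitely many bullets *)

(** Survival quantifies over evolutions, families of sets indexed by real time, so its measurability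
    is not immediate. On regular configurations the evolution exists and is unique, and for finitely
    many bullets it is encoded by a finite list of colliding pairs; there are only countably many
    such lists.

    The delicate point of the slow half is to discard the past of the last survivor [b_i]. A
    potential survivor of the process started after [b_i] is known to be one of the whole process
    only if [b_i] is not hit in the truncated process, and truncation may create hits that the
    infinite process does not have. The fast half at speed [v_i] leaves only finitely many bullets
    that could make such a hit, so these hits disappear once the truncation is long enough.

    Both final constructions prescribe the next bullets independently of the past, whereas the time,
    lead, indices and speed bounds they must respect are random. These are made deterministic by
    countable exhaustion, the speed bounds being taken among levels beyond which [mu] still has
    positive mass. *)

Section Evolution.
Variables (R : realType) (v tau : nat -> R).
Implicit Types (J K I : set nat) (A B : R -> set nat) (s t : R) (i j k : nat).

Definition pos i s : R := v i * (s - tau i).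

Definition coll A s i j : Prop := [/\ i != j, A s i, A s j & pos i s = pos j s].

Definition evol J A : Prop := forall t i, A t i <->
  [/\ J i, tau i <= t & forall s j, s < t -> ~ coll A s i j].

(* The first velocity may vanish, since the theorem allows [v = 0] for [b_0]. *)
Record regular : Prop := Regular {
  regular_mono : forall i j, (i < j)%N -> tau i < tau j;
  regular_unbounded : forall t, exists i, t < tau i;
  regular_ge0 : forall i, 0 <= v i;
  regular_gt0 : forall i, (0 < i)%N -> 0 < v i }.

Definition meeting s : Prop :=
  exists i j, [/\ i != j, tau i <= s, tau j <= s & pos i s = pos j s].

Definition meets_before s t : Prop := s < t /\ meeting s.

(** The difference of the two affine functions changes sign on [[p, s]], so it vanishes there; for
    equal slopes it is constant, hence zero. Every argument that overtaking forces a meeting rests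
    on this. *)
Lemma line_cross (a al c ga p s : R) : p <= s ->
  a * (p - al) <= c * (p - ga) -> c * (s - ga) <= a * (s - al) ->
  exists r, [/\ p <= r, r <= s & a * (r - al) = c * (r - ga)].
Proof.
move=> ps h1 h2.
have [acE|ac] := eqVneq a c.
  by exists p; split => //; subst c; apply/eqP; rewrite eq_le h1 /=; nra.
pose r := (a * al - c * ga) / (a - c).
have rE : (a - c) * r = a * al - c * ga by rewrite mulrC divfK // subr_eq0.
have {}ac : a - c != 0 by rewrite subr_eq0.
exists r; split; last by lra.
- rewrite leNgt; apply/negP => rp.
  have [ac0|ac0|/eqP] := ltgtP (a - c) 0; last by rewrite (negbTE ac).
    have : (a - c) * (s - r) < 0 by rewrite nmulr_rlt0 //; lra.
    by lra.
  have : 0 < (a - c) * (p - r) by rewrite pmulr_rgt0 //; lra.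
  by lra.
- rewrite leNgt; apply/negP => sr.
  have [ac0|ac0|/eqP] := ltgtP (a - c) 0; last by rewrite (negbTE ac).
    have : 0 < (a - c) * (p - r) by rewrite nmulr_rgt0 //; lra.
    by lra.
  have : (a - c) * (s - r) < 0 by rewrite pmulr_rlt0 //; lra.
  by lra.
Qed.

Lemma evol_fired J A t i : evol J A -> A t i -> tau i <= t.
Proof. by move=> eA /eA[]. Qed.

Lemma evol_mem J A t i : evol J A -> A t i -> J i.
Proof. by move=> eA /eA[]. Qed.

Lemma evol_before J A s t i : evol J A -> A t i -> tau i <= s -> s <= t -> A s i.
Proof.
move=> eA /eA[Ji it nc] iS st; apply/eA; split => // r j rs.
by apply: nc; exact: lt_le_trans rs st.
Qed.

Lemma coll_sym A s i j : coll A s i j -> coll A s j i.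
Proof. by case=> ij Ai Aj e; split => //; rewrite eq_sym. Qed.

Lemma coll_meeting J A s i j : evol J A -> coll A s i j -> meeting s.
Proof.
by move=> eA [ij Ai Aj e]; exists i, j; split => //; exact: evol_fired eA _.
Qed.

Lemma coll_last J A s t i j : evol J A -> coll A s i j -> A t i -> t <= s.
Proof.
by move=> eA c /eA[_ _ /(_ s j)]; case: leP => // st /(_ isT).
Qed.

Hypothesis reg : regular.

Let mono := regular_mono reg.

Lemma regular_le i j : (i <= j)%N -> tau i <= tau j.
Proof. by rewrite leq_eqVlt => /predU1P[->//|/mono/ltW]. Qed.

(** Before [t] only finitely many bullets have been fired, and each pair of trajectories meets at
    most once, so only finitely many meeting times lie below [t]. *)
Lemma meets_before_wf : well_founded meets_before.
Proof.
have H (l : seq R) t : (forall s, meets_before s t -> s \in l) -> Acc meets_before t.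
  have [n] := ubnP (size l); elim: n => [//|n IH] in l t * => ln tl.
  constructor => s st.
  apply: (IH [seq x <- l | x < s]).
    apply: leq_trans (ltnSE ln); rewrite size_filter.
    rewrite -(count_predC (fun x => x < s) l) -addn1 leq_add2l -has_count.
    by apply/hasP; exists s; [exact: tl|rewrite /= ltxx].
  move=> r [rs mr]; rewrite mem_filter rs /=; apply: tl; split => //.
  by apply: lt_trans rs _; case: st.
move=> t; have [N tN] := regular_unbounded reg t.
(* The only solution [s] of [pos i s = pos j s]. *)
pose f i j := (v j * tau j - v i * tau i) / (v j - v i).
apply: (H [seq f i j | i <- iota 0 N, j <- iota 0 N]) => s [st [i [j [ij ii jj e]]]].
have bd k : tau k <= s -> (k < N)%N.
  move=> ks; rewrite ltnNge; apply/negP => /regular_le Nk.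
  by have := le_lt_trans (le_trans Nk ks) (lt_trans st tN); rewrite ltxx.
apply/allpairsP; exists (i, j); split; rewrite ?mem_iota ?bd//=.
(* Parallel trajectories do not meet: one of two distinct bullets is not [b_0], so the common
   velocity is nonzero, and the firing times differ. *)
have vij : v j - v i != 0.
  rewrite subr_eq0; apply/eqP => vji; move: e; rewrite /pos vji => e.
  have vi0 : v i != 0.
    move: ij; case: i j {ii jj e} vji => [|i] [|j]// vji _.
    - by rewrite -vji gt_eqF// regular_gt0.
    - by rewrite gt_eqF// regular_gt0.
    - by rewrite gt_eqF// regular_gt0.
  have := mulfI vi0 e.
  by move: ij; case: (ltngtP i j) => // /mono; lra.
rewrite /f; apply: (canRL (mulfK vij)); move: e; rewrite /pos; lra.
Qed.

(** Recursion along all earlier times would not be well founded; collisions occur only at meeting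
    times, so it is enough to recurse along those. *)
Lemma evol_exists J : exists A, evol J A.
Proof.
pose F t (rec : forall s, meets_before s t -> set nat) : set nat :=
  fun i => [/\ J i, tau i <= t & forall s (h : meets_before s t) j,
    ~ [/\ i != j, rec s h i, rec s h j & pos i s = pos j s]].
pose A := Fix meets_before_wf (fun=> set nat) F.
have AE t : A t = F t (fun s _ => A s).
  rewrite /A Fix_eq // => {}t f g fg; rewrite /F.
  by rewrite (_ : f = g)//; apply: functional_extensionality_dep => s;
    apply: functional_extensionality_dep => h.
exists A => t i; split; rewrite {1}AE => -[Ji it nc]; split => //.
- move=> s j st c; apply: (nc s _ j) => //; split => //; exists i, j.
  by case: c => ij; rewrite !AE => -[_ ? _] [_ ? _].
- by move=> s [st _] j; exact: nc.
Qed.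

(* If no bullet of [I] meets one outside [I] before [T], then up to time [T] the
   evolution on [I] only depends on [I]; this covers uniqueness, restriction to a
   non-interacting part, and truncation of the set of bullets. *)
Lemma evol_agree I T J J' A A' : evol J A -> evol J' A' ->
  (forall i, I i -> tau i <= T -> J i <-> J' i) ->
  (forall s i j, s < T -> I i -> coll A s i j -> I j) ->
  (forall s i j, s < T -> I i -> coll A' s i j -> I j) ->
  forall t i, t <= T -> I i -> A t i <-> A' t i.
Proof.
move=> eA eA' JJ cA cA'; elim/(well_founded_ind meets_before_wf) => t IH i tT Ii.
split=> [/eA|/eA'] [Ji it nc]; [apply/eA'|apply/eA]; split => //.
- by apply/(JJ i) => //; exact: le_trans it tT.
- move=> s j st c; apply: (nc s j st); have sT := lt_le_trans st tT.
  have Ij := cA' _ _ _ sT Ii c; have ms := coll_meeting eA' c.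
  by case: c => ij Ai Aj e; split => //; apply/(IH s) => //; exact: ltW.
- by apply/(JJ i) => //; exact: le_trans it tT.
- move=> s j st c; apply: (nc s j st); have sT := lt_le_trans st tT.
  have Ij := cA _ _ _ sT Ii c; have ms := coll_meeting eA c.
  by case: c => ij Ai Aj e; split => //; apply/(IH s) => //; exact: ltW.
Qed.

Lemma evol_unique J A A' : evol J A -> evol J A' -> A = A'.
Proof.
move=> eA eA'; apply/funext => t; apply/seteqP.
by split=> i; apply (@evol_agree setT t J J).
Qed.

(** The later bullet starts behind, so it could get ahead only through a meeting strictly before
    [s], which would have annihilated both. *)
Lemma evol_order J A s i j : evol J A -> (i < j)%N -> A s i -> A s j -> pos j s <= pos i s.
Proof.
move=> eA ij Ai Aj; rewrite leNgt; apply/negP => c.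
have js := evol_fired eA Aj.
have [] := @line_cross (v j) (tau j) (v i) (tau i) (tau j) s js.
- by rewrite subrr mulr0 mulr_ge0 ?regular_ge0// subr_ge0 ltW// mono.
- exact: ltW.
move=> r [jr rs e].
have {}rs : r < s by rewrite lt_neqAle rs andbT; apply/eqP => rE; move: c; rewrite /pos -rE; lra.
have ijr : tau i <= r by apply: le_trans jr; exact/ltW/mono.
have Ari := evol_before eA Ai ijr (ltW rs).
have Arj := evol_before eA Aj jr (ltW rs).
have cr : coll A r i j by split => //; rewrite ltn_eqF.
by have := coll_last eA cr Ai; rewrite leNgt rs.
Qed.

End Evolution.

(** * Survival, and splitting of the process along a surviving bullet *)

Section Survival.
Variables (R : realType) (v tau : nat -> R).
Implicit Types (J K I : set nat) (A B : R -> set nat) (s t : R) (i j k : nat).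

(** The evolution as a function of [J]; on regular configurations the default [set0] is never taken
    ([evP]). *)
Definition ev J : R -> set nat := xget (fun=> set0) [set A | evol v tau J A].

Definition surv J i : Prop := J i /\ forall t, tau i <= t -> ev J t i.

(* The line of speed [v0] leaving the origin at time [tau0] is a mere obstacle:
   it takes no part in the process. *)
Definition hits K (tau0 v0 : R) : Prop :=
  exists s j, ev K s j /\ pos v tau j s = v0 * (s - tau0).

Definition upto J k : set nat := J `&` [set i | (i <= k)%N].
Definition after J k : set nat := J `&` [set i | (k < i)%N].

Hypothesis reg : regular v tau.

Local Notation pos := (pos v tau).
Local Notation coll := (coll v tau).

Let mono := regular_mono reg.
Let ge0 := regular_ge0 reg.

Lemma evP J : evol v tau J (ev J).
Proof. by have [A eA] := evol_exists reg J; rewrite /ev; case: xgetP => [B ->//|/(_ A)]. Qed.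

Lemma ev_unique J A : evol v tau J A -> A = ev J.
Proof. by move=> eA; apply: (evol_unique reg eA); exact: evP. Qed.

Lemma survP J i : surv J i <-> J i /\ forall s j, ~ coll (ev J) s i j.
Proof.
split=> [[Ji ai]|[Ji nc]]; split => //.
- move=> s j c; have is' : tau i <= s by case: c => _ /(evol_fired (evP J)).
  have /(coll_last (evP J) c) : ev J (s + 1) i by apply: ai; lra.
  lra.
- by move=> t it; apply/evP; split.
Qed.

(** The case of [evol_agree] where [I] is everything; it compares truncated processes with the
    infinite one on bounded time intervals. *)
Lemma ev_agree J J' T : (forall i, tau i <= T -> J i <-> J' i) ->
  forall t i, t <= T -> ev J t i <-> ev J' t i.
Proof.
move=> JJ t i tT; apply (@evol_agree _ _ _ reg setT T J J') => //; first exact: evP.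
- exact: evP.
- by move=> j _; exact: JJ.
Qed.

Lemma ev_upto J k T : (forall t i j, t < T -> (i <= k < j)%N -> ~ coll (ev J) t i j) ->
  forall t i, t <= T -> (i <= k)%N -> ev J t i <-> ev (upto J k) t i.
Proof.
move=> nc t i tT ik.
apply (@evol_agree _ _ _ reg [set i | (i <= k)%N] T J (upto J k)) => //.
- exact: evP.
- exact: evP.
- by move=> j /= jk _; split => // -[].
- move=> s i0 j sT /= i0k c; rewrite leqNgt; apply/negP => kj.
  by apply: nc sT _ c; rewrite i0k.
- by move=> s i0 j sT /= i0k [_ _ /(evol_mem (evP _))[]].
Qed.

Lemma ev_after J k : (forall t i j, (i <= k < j)%N -> ~ coll (ev J) t i j) ->
  forall t i, (k < i)%N -> ev J t i <-> ev (after J k) t i.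
Proof.
move=> nc t i ki.
apply (@evol_agree _ _ _ reg [set i | (k < i)%N] t J (after J k)) => //.
- exact: evP.
- exact: evP.
- by move=> j /= jk _; split => // -[].
- move=> s i0 j sT /= i0k c; rewrite ltnNge; apply/negP => kj.
  by apply: (nc s j i0); [rewrite kj|exact: coll_sym].
- by move=> s i0 j sT /= i0k [_ _ /(evol_mem (evP _))[]].
Qed.

(** While [b_k] is active, [evol_order] keeps earlier bullets from being behind it and later ones
    from being ahead. A collision across it would therefore happen at its own position and involve
    it. *)
Lemma shielded J k s i j : (forall t, tau k <= t -> t <= s -> ev J t k) ->
  (forall t l, t <= s -> ~ coll (ev J) t k l) ->
  (i <= k < j)%N -> ~ coll (ev J) s i j.
Proof.
move=> ak nk /andP[ik kj] c; have [_ ai aj e] := c.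
have ks : tau k <= s by apply: le_trans (evol_fired (evP J) aj); exact/ltW/mono.
have {}ak := ak _ ks (lexx _).
have h1 := evol_order reg (evP J) kj ak aj.
move: ik; rewrite leq_eqVlt => /predU1P[ik|ik].
  by apply: (nk s j (lexx _)); rewrite -ik.
have h2 := evol_order reg (evP J) ik ai ak.
apply: (nk s j (lexx _)); split => //; first by rewrite ltn_eqF.
by apply/eqP; rewrite eq_le h1 andbT -e.
Qed.

(** The superposition of the two evolutions satisfies the defining property of [evol], so uniqueness
    applies. *)
Lemma ev_union I K : (forall i, ~ (I i /\ K i)) ->
  (forall s i j, ev I s i -> ev K s j -> pos i s <> pos j s) ->
  forall t i, ev (I `|` K) t i <-> ev I t i \/ ev K t i.
Proof.
move=> dis nm t i.
suff : evol v tau (I `|` K) (fun t => ev I t `|` ev K t) by move=> /ev_unique <-.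
move=> {}t {}i; split.
- move=> [ai|ai].
  + split; [by left; exact: evol_mem (evP I) ai|exact: evol_fired (evP I) ai|].
    move=> s j st [ij ai' aj e].
    have is' : tau i <= s by case: ai' => [/(evol_fired (evP I))|/(evol_fired (evP K))].
    have ai2 := evol_before (evP I) ai is' (ltW st).
    case: aj => [aj|/(nm _ _ _ ai2)//].
    by have := coll_last (evP I) (And4 ij ai2 aj e) ai; rewrite leNgt st.
  + split; [by right; exact: evol_mem (evP K) ai|exact: evol_fired (evP K) ai|].
    move=> s j st [ij ai' aj e].
    have is' : tau i <= s by case: ai' => [/(evol_fired (evP I))|/(evol_fired (evP K))].
    have ai2 := evol_before (evP K) ai is' (ltW st).
    case: aj => [aj|aj]; first by case: (nm _ _ _ aj ai2).
    by have := coll_last (evP K) (And4 ij ai2 aj e) ai; rewrite leNgt st.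
- move=> [[Ii|Ki] it nc]; [left|right]; apply/evP; split => // s j st [ij ai aj e].
    by apply: (nc s j st); split => //; left.
  by apply: (nc s j st); split => //; right.
Qed.

Lemma upto_after J k : J = upto J k `|` after J k.
Proof.
apply/seteqP; split=> i; last by move=> [[]|[]].
by move=> Ji; case: (leqP i k) => ik; [left|right].
Qed.

Lemma surv_shield J k s i j : surv J k -> (i <= k < j)%N -> ~ coll (ev J) s i j.
Proof.
move=> sk; apply: shielded => [t kt _|t l _]; first by case: sk => _ /(_ _ kt).
by have /survP[_] := sk; exact.
Qed.

Lemma surv_upto J k i : surv J k -> (i <= k)%N -> surv J i <-> surv (upto J k) i.
Proof.
move=> sk ik; have E t : ev J t i <-> ev (upto J k) t i.
  apply: (@ev_upto J k t) => // s i0 j _; exact: surv_shield.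
split => [[Ji h]|[[Ji _] h]]; split => // t it; by [split|apply/E/h].
Qed.

Lemma surv_after J k i : surv J k -> (k < i)%N -> surv J i <-> surv (after J k) i.
Proof.
move=> sk ki; have E t : ev J t i <-> ev (after J k) t i.
  apply: (@ev_after J k) => // s i0 j; exact: surv_shield.
split => [[Ji h]|[[Ji _] h]]; split => // t it; by [split|apply/E/h].
Qed.

Lemma surv_not_hit J k : surv J k -> ~ hits (after J k) (tau k) (v k).
Proof.
move=> sk [s [j [aj e]]].
have [_ kj] := evol_mem (evP _) aj.
have {}aj : ev J s j by apply/(ev_after (fun s i j => @surv_shield J k s i j sk)).
have /survP[_ /(_ s j)] := sk; apply; split => //; first by rewrite ltn_eqF.
case: sk => _; apply; apply: le_trans (evol_fired (evP J) aj); exact/ltW/mono.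
Qed.

(** An active earlier bullet is not behind [b_k], so a later bullet meeting it would have crossed
    the line of [b_k] on the way. *)
Lemma not_hit_split J k : surv (upto J k) k -> ~ hits (after J k) (tau k) (v k) ->
  forall t i, ev J t i <-> ev (upto J k) t i \/ ev (after J k) t i.
Proof.
move=> sk nh t i; rewrite {1}(upto_after J k); apply: ev_union => [{}i|s {}i j ai aj e].
  by move=> [[_ /= h1] [_ /= h2]]; move: h2; rewrite ltnNge h1.
have [_ ik] := evol_mem (evP _) ai; have [_ kj] := evol_mem (evP _) aj.
have js := evol_fired (evP _) aj.
have ks : tau k < s by apply: lt_le_trans js; exact: mono.
have ak : ev (upto J k) s k by case: sk => _; apply; exact: ltW.
have h : pos k s <= pos i s.
  move: ik => /=; rewrite leq_eqVlt => /predU1P[->//|ik].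
  by have := evol_order reg (evP _) ik ai ak.
apply: nh; have [] := @line_cross _ (v j) (tau j) (v k) (tau k) (tau j) s js.
- by rewrite subrr mulr0 mulr_ge0// subr_ge0 ltW// mono.
- by rewrite -/(pos k s) -/(pos j s) -e.
- move=> r [jr rs er]; exists r, j; split => //.
  exact: evol_before (evP _) aj jr rs.
Qed.

Lemma not_hit_surv J k : surv (upto J k) k -> ~ hits (after J k) (tau k) (v k) -> surv J k.
Proof.
move=> sk nh; split; first by case: sk => -[].
by move=> t kt; apply/(not_hit_split sk nh); left; case: sk => _; apply.
Qed.

Lemma surv_hits J j (tau0 v0 : R) : 0 <= v0 -> tau0 <= tau j -> v0 < v j -> surv J j ->
  hits J tau0 v0.
Proof.
move=> v00 t0 vj [_ sj].
have p : 0 < v j - v0 by lra.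
(* The instant at which bullet [j] catches the line of speed [v0] that left at [tau0]. *)
pose s := tau j + v0 * (tau j - tau0) / (v j - v0).
have js : tau j <= s by rewrite lerDl divr_ge0 ?(ltW p)// mulr_ge0// subr_ge0.
exists s, j; split; first exact: sj.
by rewrite /pos /s; field; rewrite gt_eqF.
Qed.

(** From [tau1] on, the line of speed [v1] is never ahead of the other one, so a bullet fired after
    [tau1] crosses it before reaching the other. *)
Lemma hits_mono K (tau0 v0 tau1 v1 : R) : 0 <= v1 -> tau0 <= tau1 -> v1 <= v0 ->
  (forall j, K j -> tau1 <= tau j) -> hits K tau0 v0 -> hits K tau1 v1.
Proof.
move=> v10 t01 vv Kt [s [j [aj e]]].
have js := evol_fired (evP _) aj.
have jt := Kt _ (evol_mem (evP _) aj).
have [] := @line_cross _ (v j) (tau j) v1 tau1 (tau j) s js.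
- by rewrite subrr mulr0 mulr_ge0// subr_ge0.
- by move: e; rewrite /pos => ->; apply: ler_pM => //; lra.
- move=> r [jr rs er]; exists r, j; split => //.
  exact: evol_before (evP _) aj jr rs.
Qed.

(** The witness is the hitting bullet of least index. It links lines to potential survivors: a line
    can be hit only if some potential survivor is faster than it. *)
Lemma hits_first K (tau0 v0 : R) : 0 <= v0 -> (forall j, K j -> tau0 < tau j) -> (forall j, K j -> 0 < v j) ->
  hits K tau0 v0 -> exists s j,
  [/\ ev K s j, pos j s = v0 * (s - tau0), surv (upto K j) j & v0 < v j].
Proof.
move=> v00 Kt Kv [s0 [j0 h0]].
have [j [[s [aj e]] jmin]] : exists j, (exists s, ev K s j /\ pos j s = v0 * (s - tau0)) /\
    forall i, (i < j)%N -> ~ exists s, ev K s i /\ pos i s = v0 * (s - tau0).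
  pose p j := `[< exists s, ev K s j /\ pos j s = v0 * (s - tau0) >].
  have exp : exists j, p j by exists j0; apply/asboolP; exists s0.
  case: (ex_minnP exp) => j /asboolP pj jm; exists j; split => // i ij pi.
  by move: ij; rewrite ltnNge jm//; exact/asboolP.
have Kj := evol_mem (evP _) aj; have js := evol_fired (evP _) aj.
exists s, j; split => //; last first.
  rewrite ltNge; apply/negP => vj; have := Kt _ Kj; have := Kv _ Kj; move: e; rewrite /pos.
  have [e|e] := eqVneq v0 0; first by lra.
  have {e} : 0 < v0 by rewrite lt_neqAle eq_sym e.
  by nra.
(* Up to time [s] bullet [j] is active and shields the earlier bullets from the later ones. *)
have agree t i : t <= s -> (i <= j)%N -> ev K t i <-> ev (upto K j) t i.
  apply: (@ev_upto K j s) => t' i' j' ts; apply: shielded => [r jr rt|r l rt c].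
    by apply: evol_before (evP _) aj jr _; lra.
  by have := coll_last (evP K) c aj; lra.
have aj' : ev (upto K j) s j by apply/agree.
(* An earlier bullet still active at [s] would be at or beyond the line, so it would have hit the
   line itself, against the minimality of [j]. *)
have alone i : (i < j)%N -> ~ ev (upto K j) s i.
  move=> ij ai; have := evol_order reg (evP _) ij ai aj'; rewrite e => le.
  have is' := evol_fired (evP _) ai; have [Ki _] := evol_mem (evP _) ai.
  have [] := @line_cross _ (v i) (tau i) v0 tau0 (tau i) s is' _ le.
    by rewrite subrr mulr0 mulr_ge0// subr_ge0 ltW// Kt.
  move=> r [ir rs er]; apply: (jmin i ij); exists r; split => //.
  by apply/agree => //; [exact: ltnW|apply: evol_before (evP _) ai ir rs].
apply/survP; split; first by split => /=.
move=> r i c; have sr := coll_last (evP _) c aj'.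
have [ij _ ai _] := c; have [Ki /= ij'] := evol_mem (evP _) ai.
have {}ij : (i < j)%N by rewrite ltn_neqAle eq_sym ij.
apply: (alone i ij); apply: evol_before (evP _) ai _ sr.
by apply: le_trans js; exact/ltW/mono.
Qed.

End Survival.

(** * Renumbering of the bullets and translation of time *)

Section Shift.
Variables (R : realType) (v tau v' tau' : nat -> R) (J J' : set nat) (k : nat) (c : R).
Hypothesis JJ' : forall i, J' i <-> J (k + i)%N.
Hypothesis Jk : forall j, J j -> (k <= j)%N.
Hypothesis vv' : forall i, J' i -> v' i = v (k + i)%N.
Hypothesis tautau' : forall i, J' i -> tau' i = tau (k + i)%N - c.

(** The configurations are compared on [J'] only, so with [k = 0] and [c = 0] this also covers two
    configurations that agree on the bullets in play, such as a truncated one. *)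
Lemma evol_shift A : evol v tau J A -> evol v' tau' J' (fun t i => A (t + c) (k + i)%N).
Proof.
move=> eA; have Apos i s : J' i -> pos v' tau' i s = pos v tau (k + i) (s + c).
  by move=> Ji; rewrite /pos vv'// tautau'//; congr (_ * _); ring.
have Amem t i : A (t + c) (k + i)%N -> J' i by move/(evol_mem eA)/JJ'.
move=> t i; split.
- move=> ai; have Ji := Amem _ _ ai; have it := evol_fired eA ai.
  split => //; first by rewrite tautau'//; lra.
  move=> s j st [ij ai' aj e]; have Jj := Amem _ _ aj.
  have : coll v tau A (s + c) (k + i) (k + j).
    by split => //; [rewrite eqn_add2l|rewrite -!Apos].
  by move=> /(coll_last eA) /(_ ai); rewrite lerD2r leNgt st.
- move=> [Ji it nc]; apply/eA; split; [exact/JJ'|by move: it; rewrite tautau'//; lra|].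
  move=> s j st [ij ai aj e].
  have kj := Jk (evol_mem eA aj).
  apply: (nc (s - c) (j - k)%N); first by lra.
  split.
  + by move: ij; rewrite -[j in (_ != j)](subnKC kj) eqn_add2l.
  + by rewrite subrK.
  + by rewrite subrK subnKC.
  + have Jj : J' (j - k)%N by apply/JJ'; rewrite subnKC//; exact: evol_mem eA aj.
    by rewrite !Apos// subrK subnKC.
Qed.

Hypotheses (reg : regular v tau) (reg' : regular v' tau').

Lemma ev_shift t i : ev v' tau' J' t i <-> ev v tau J (t + c) (k + i)%N.
Proof. by rewrite -(ev_unique reg' (evol_shift (evP reg J))). Qed.

Lemma surv_shift i : surv v' tau' J' i <-> surv v tau J (k + i)%N.
Proof.
split=> -[Ji h]; split.
- exact/JJ'.
- move=> t it; have := h (t - c); rewrite ev_shift subrK; apply.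
  by rewrite tautau'//; lra.
- exact/JJ'.
- by move=> t; rewrite tautau'; [move=> it; apply/ev_shift/h; lra|exact/JJ'].
Qed.

Lemma hits_shift tau0 v0 : hits v' tau' J' (tau0 - c) v0 <-> hits v tau J tau0 v0.
Proof.
have Apos i s : J' i -> pos v' tau' i s = pos v tau (k + i) (s + c).
  by move=> Ji; rewrite /pos vv'// tautau'//; congr (_ * _); ring.
split=> -[s [j [aj e]]].
- have aj' := (ev_shift _ _).1 aj; exists (s + c), (k + j)%N; split => //.
  by rewrite -Apos ?e; [ring|apply/JJ'; exact: evol_mem (evP reg _) aj'].
- have Jj := evol_mem (evP reg _) aj; have kj := Jk Jj.
  exists (s - c), (j - k)%N; split; first by apply/ev_shift; rewrite subrK subnKC.
  by rewrite Apos ?subrK ?subnKC// ?e; [ring|apply/JJ'; rewrite subnKC].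
Qed.

End Shift.

Lemma upto_from m n : upto (bullets_from m) n = bullets_between m n.
Proof.
by apply/seteqP; split=> i; [move=> [mi iN]; apply/andP|move=> /andP[mi iN]; split].
Qed.

Lemma after_from m n : (m <= n.+1)%N -> after (bullets_from m) n = bullets_from n.+1.
Proof.
move=> mn; apply/seteqP; split=> i; first by move=> [].
by move=> ni; split => //; exact: leq_trans ni.
Qed.

Lemma upto_between m k n : (k <= n)%N -> upto (bullets_between m n) k = bullets_between m k.
Proof.
move=> kn; apply/seteqP; split=> i; first by move=> [/andP[mi _] ik]; apply/andP.
by move=> /andP[mi ik]; split => //; apply/andP; split => //; exact: leq_trans kn.
Qed.

Lemma after_between m k n : (m <= k.+1)%N -> after (bullets_between m n) k = bullets_between k.+1 n.
Proof.
move=> mk; apply/seteqP; split=> i; first by move=> [/andP[_ iN] ki]; apply/andP.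
by move=> /andP[ki iN]; split => //; apply/andP; split => //; exact: leq_trans ki.
Qed.

Lemma finite_nat_bounded (A : set nat) : finite_set A -> exists N, forall n, A n -> (n < N)%N.
Proof.
move=> /finite_seqP[s ->]; exists (\max_(i <- s) i).+1 => n /= ns.
by rewrite ltnS; apply: (@leq_bigmax_seq _ s xpredT id).
Qed.

Lemma bounded_finite_nat (A : set nat) N : (forall n, A n -> (n < N)%N) -> finite_set A.
Proof. by move=> AN; apply: sub_finite_set (finite_II N) => n /AN. Qed.

(** The orbits [{x, f x}] have two elements and are removed one by one. *)
Lemma odd_card_fixfree_involution (T : finType) (f : T -> T) (A : {set T}) :
  involutive f -> (forall x, f x != x) -> (forall x, x \in A -> f x \in A) -> ~~ odd #|A|.
Proof.
move=> fI fne; have [n] := ubnP #|A|; elim: n A => // n IH A An fA.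
have [->|[x xA]] := set_0Vmem A; first by rewrite cards0.
have fxA : f x \in A :\ x by rewrite !inE fne fA.
rewrite (cardsD1 x) xA (cardsD1 (f x)) fxA /= negbK; apply: IH.
  by move: An; rewrite (cardsD1 x) xA (cardsD1 (f x)) fxA; lia.
move=> y; rewrite !inE => /and3P[y1 y2 yA]; rewrite fA// andbT.
by apply/andP; split; [apply: contra y2 => /eqP/(can_inj fI) ->
  |apply: contra y1 => /eqP <-; rewrite fI].
Qed.

(** * Potential survivors and removal of the past of a survivor *)

Section Configurations.
Variables (R : realType) (v tau : nat -> R).
Hypothesis reg : regular v tau.
Let mono := regular_mono reg.
Let ge0 := regular_ge0 reg.

Local Notation surv := (surv v tau).
Local Notation ev := (ev v tau).
Local Notation hits := (hits v tau).
Local Notation pos := (pos v tau).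

(** For [m = 0] this is membership in [PS]; other values of [m] start the process afresh at
    [b_m]. *)
Definition last_survives m n : Prop := surv (bullets_between m n) n.

Lemma surv_from_last m n : surv (bullets_from m) n -> last_survives m n.
Proof. by move=> s; have := (surv_upto reg s (leqnn _)).1 s; rewrite upto_from. Qed.

Lemma last_survives_upto m i n : surv (bullets_between m n) i -> last_survives m i.
Proof.
move=> s; have /= /andP[_ iN] := s.1.
by have := (surv_upto reg s (leqnn _)).1 s; rewrite upto_between.
Qed.

Lemma last_survives_forever k (v0 : R) : 0 <= v0 -> v0 < v k -> last_survives 0 k ->
  ~ hits (bullets_from k.+1) (tau k) v0 -> surv (bullets_from 0) k.
Proof.
move=> v00 vk sk nh; apply: (not_hit_surv reg).
  by rewrite upto_from.
rewrite after_from// => /(hits_mono reg v00 (lexx _) (ltW vk)) h; apply: nh; apply: h.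
by move=> j /= kj; exact/ltW/mono.
Qed.

Lemma unhit_last_survives_unique k l (v0 : R) : 0 <= v0 -> (k < l)%N ->
  last_survives 0 k -> v0 < v k -> ~ hits (bullets_from k.+1) (tau k) v0 ->
  last_survives 0 l -> v0 < v l -> ~ hits (bullets_from l.+1) (tau l) v0 -> False.
Proof.
move=> v00 kl sk vk nk sl vl nl; apply: (nk).
have Sk := last_survives_forever v00 vk sk nk; have Sl := last_survives_forever v00 vl sl nl.
apply: (surv_hits v00 (ltW (mono kl)) vl).
by have := (surv_after reg Sk kl).1 Sl; rewrite after_from.
Qed.

Section Stabilization.
Variables (v0 : R) (fin : finite_set [set n | last_survives 0 n /\ v0 < v n]).

(** If some survivor is faster than [v0], take [m = i.+1] for the last such [i]. For large [n],
    [b_i] also survives among [b_0, ..., b_n] and acts as a shield, so potential survivors of the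
    process from [i.+1] are potential survivors of the whole process. *)
Lemma last_survivor_reduction :
  (forall i, ~ hits (bullets_from i.+1) (tau i) (v i) ->
     finite_set [set n | last_survives i.+1 n /\ v i < v n]) ->
  exists m, finite_set [set n | last_survives m n /\ v0 < v n] /\
            forall i, surv (bullets_from m) i -> v i <= v0.
Proof.
move=> N.
have [[i0 [si0 vi0]]|none] := pselect (exists i, surv (bullets_from 0) i /\ v0 < v i); last first.
  exists 0%N; split => // i si; rewrite leNgt; apply/negP => vi; apply: none; by exists i.
have [K Kb] := finite_nat_bounded fin.
have [i [si vi] imax] : exists2 i, surv (bullets_from 0) i /\ v0 < v i &
    forall j, surv (bullets_from 0) j /\ v0 < v j -> (j <= i)%N.
  pose p j := `[< surv (bullets_from 0) j /\ v0 < v j >].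
  have ep : exists j, p j by exists i0; apply/asboolP.
  have pK j : p j -> (j <= K)%N.
    by move=> /asboolP[sj vj]; apply/ltnW/Kb; split => //; exact: surv_from_last.
  case: (ex_maxnP ep pK) => i /asboolP pi im; exists i => // j pj; apply: im; exact/asboolP.
have nh : ~ hits (bullets_from i.+1) (tau i) (v i).
  by have := surv_not_hit reg si; rewrite after_from.
have [K1 K1b] := finite_nat_bounded (N i nh).
(* The time at which bullet [j] would cross the line of [b_i]; the sum of absolute values [T] bounds
   the crossing times of all [j < K1]. *)
pose m j : R := (v j * tau j - v i * tau i) / (v j - v i).
pose T : R := \sum_(j < K1) `|m j|.
have [K2 TK2] := regular_unbounded reg T.
(* A hit in the truncated process comes with a hitter of index below [K1], thus at a time at most
   [T], up to which the truncated and the infinite process agree. *)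
have late n : (K2 <= n)%N -> ~ hits (bullets_between i.+1 n) (tau i) (v i).
  move=> K2n /(hits_first reg (ge0 i)) [||s [j [aj e sj vj]]].
  - by move=> j /andP[/mono ij _].
  - by move=> j /andP[ij _]; apply: (regular_gt0 reg); exact: leq_ltn_trans ij.
  have /= /andP[ij jn] := evol_mem (evP reg _) aj.
  have jK1 : (j < K1)%N by apply: K1b; split => //; move: sj; rewrite upto_between.
  have sE : s = m j.
    by move: e; rewrite /pos /m => e; apply: (canRL (mulfK _)); [rewrite subr_eq0 gt_eqF|lra].
  have sT : s <= T.
    rewrite sE (le_trans (ler_norm _))// /T (bigD1 (Ordinal jK1))//= lerDl.
    by apply: sumr_ge0.
  have ag l : tau l <= T -> bullets_between i.+1 n l <-> bullets_from i.+1 l.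
    move=> lT; split=> [/andP[]//|il]; apply/andP; split => //.
    rewrite leqNgt; apply/negP => nl.
    by have := regular_le reg (ltnW (leq_ltn_trans K2n nl)); lra.
  by apply: nh; exists s, j; split => //; exact: ((ev_agree reg ag _ sT).1 aj).
exists i.+1; split; last first.
  move=> j sj; rewrite leNgt; apply/negP => vj.
  have ij : (i < j)%N by case: sj.
  have sj0 : surv (bullets_from 0) j by apply/(surv_after reg si ij); rewrite after_from.
  by have := imax j (conj sj0 vj); rewrite leqNgt ij.
apply: (@bounded_finite_nat _ (maxn K K2)) => n [sn vn].
rewrite leq_max; case: (leqP K2 n) => [K2n|]; last by rewrite orbT.
rewrite orbF; apply: Kb; split => //.
have /= /andP[ii _] := sn.1.
have ln : (i <= n)%N := ltnW ii.
have sin : surv (bullets_between 0 n) i.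
  apply: (not_hit_surv reg); first by rewrite upto_between ?(ltnW ii)//; exact: (surv_from_last si).
  by rewrite after_between//; exact: late.
by have := surv_after reg sin ii; rewrite after_between// => h; exact: h.2 sn.
Qed.

End Stabilization.

End Configurations.

(** * Processes without fast survivors, parity of collisions, protective pairs *)

Section Transience.
Variables (R : realType) (v tau : nat -> R).
Hypothesis reg : regular v tau.
Let mono := regular_mono reg.
Let ge0 := regular_ge0 reg.

Local Notation surv := (surv v tau).
Local Notation ev := (ev v tau).
Local Notation hits := (hits v tau).
Local Notation pos := (pos v tau).
Local Notation coll := (coll v tau).
Local Notation last_survives := (last_survives v tau).

Section Transient.
Variables (v0 : R) (fin : finite_set [set n | last_survives 0 n /\ v0 < v n]).
Hypothesis slow_survivors : forall i, surv (bullets_from 0) i -> v i <= v0.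

(** None of the finitely many potential survivors faster than [v0] survives for ever; the sum of the
    absolute values of instants at which they are dead serves as a common [T]. *)
Lemma transient_dead : exists K (T : R), forall i, last_survives 0 i -> v0 < v i ->
  [/\ (i < K)%N, tau i <= T & ~ ev (bullets_from 0) T i].
Proof.
have [K Kb] := finite_nat_bounded fin; exists K.
have /choice[t ht] i : exists t, v0 < v i -> tau i <= t /\ ~ ev (bullets_from 0) t i.
  have [vi|_] := ltP v0 (v i); last by exists 0.
  apply: contrapT => none.
  have /slow_survivors : surv (bullets_from 0) i.
    split => // t it; apply: contrapT => nt; apply: none; by exists t.
  by rewrite leNgt vi.
pose T : R := \sum_(i < K) `|t i|; exists T => i si vi.
have iK : (i < K)%N by exact: Kb.
have [it ni] := ht i vi.
have tT : t i <= T.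
  by rewrite (le_trans (ler_norm _))// /T (bigD1 (Ordinal iK))//= lerDl sumr_ge0.
split => //; first exact: le_trans tT.
by move=> h; apply: ni; exact: evol_before (evP reg _) h it tT.
Qed.

(** A fast survivor of [b_0, ..., b_n] would be a potential survivor, dead at [T] in the infinite
    process; but for large [n] the two processes agree up to [T]. *)
Lemma transient_finite_survivors : exists N, forall n i, (N <= n)%N ->
  surv (bullets_between 0 n) i -> v i <= v0.
Proof.
have [K [T KT]] := transient_dead.
have [N TN] := regular_unbounded reg T; exists N => n i Nn si.
rewrite leNgt; apply/negP => vi.
have [iK iT nT] := KT i (last_survives_upto reg si) vi.
apply: nT; have ag l : tau l <= T -> bullets_between 0 n l <-> bullets_from 0 l.
  move=> lT; split=> // _; apply/andP; split => //.
  rewrite leqNgt; apply/negP => nl.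
  by have := regular_le reg (ltnW (leq_ltn_trans Nn nl)); lra.
by apply/(ev_agree reg ag _ (lexx _)); case: si => _; apply.
Qed.

Lemma transient_not_hits : 0 < v 0%N -> 0 < v0 ->
  exists D : nat, ~ hits (bullets_from 0) (tau 0 - D.+1%:R) v0.
Proof.
move=> vpos v00; have [K [T KT]] := transient_dead.
pose V : R := \sum_(i < K) v i.
(* The first hitter would be a potential survivor of speed at most [V], dead at [T], so within
   distance [V * (T - tau 0)] of the origin; a lead [D] puts the line at [v0 * D] already when the
   first bullet is fired. *)
pose B : R := V * `|T - tau 0| / v0.
have V0 : 0 <= V by apply: sumr_ge0.
exists (Num.bound B).
have BB : B < (Num.bound B).+1%:R.
  apply: (lt_trans (archi_boundP _)); last by rewrite ltr_nat.
  by rewrite divr_ge0 ?mulr_ge0// ltW.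
set D := (Num.bound B).+1%:R in BB *.
have D0 : 0 < D by rewrite ltr0n.
move=> h; have hlt j : tau 0 - D < tau j by have := regular_le reg (leq0n j); lra.
have [s [j [aj e sj vj]]] : exists s j, [/\ ev (bullets_from 0) s j,
    pos j s = v0 * (s - (tau 0 - D)), last_survives 0 j & v0 < v j].
  have [|j _|s [j [aj e sj vj]]] := hits_first reg (ltW v00) _ _ h.
  - by move=> j _; exact: hlt.
  - by case: j => // j; exact: (regular_gt0 reg).
  - by exists s, j; split => //; rewrite /last_survives -upto_from.
have [jK jT nT] := KT j sj vj.
have js := evol_fired (evP reg _) aj.
have sT : s < T.
  rewrite ltNge; apply/negP => Ts; apply: nT.
  exact: evol_before (evP reg _) aj jT Ts.
have vV : v j <= V by rewrite /V (bigD1 (Ordinal jK))//= lerDl sumr_ge0.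
have j0 := regular_le reg (leq0n j).
have : v0 * D <= V * `|T - tau 0|.
  apply: (@le_trans _ _ (v j * (T - tau 0))).
    by move: e; rewrite /pos; nra.
  by rewrite (le_trans (ler_norm _))// normrM ler_wpM2r// ger0_norm.
by move: BB; rewrite /B ltr_pdivrMr//; lra.
Qed.
End Transient.

(** Mapping each bullet to its unique collision partner is an involution without fixed point on
    [n.+1] bullets, since numbering starts at 0. *)
Lemma all_perish_even n :
  (forall i, ~ surv (bullets_between 0 n) i) ->
  (forall t i j k, coll (ev (bullets_between 0 n)) t i j ->
     coll (ev (bullets_between 0 n)) t i k -> j = k) -> odd n.
Proof.
set J := bullets_between 0 n => ns nt.
have mem i : J i <-> (i < n.+1)%N by split=> [/andP[]//|iN]; apply/andP.
have /choice[f hf] (i : 'I_n.+1) : exists j : 'I_n.+1, exists t, coll (ev J) t i j.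
  apply: contrapT => none; apply: (ns i); apply/(survP reg); split; first exact/mem.
  move=> s j c; apply: none; have [_ _ aj _] := c.
  have /mem jn := evol_mem (evP reg _) aj.
  by exists (Ordinal jn), s.
have same t i j t' k : coll (ev J) t i j -> coll (ev J) t' i k -> j = k.
  move=> c c'; have [_ ai _ _] := c; have [_ ai' _ _] := c'.
  have tt : t = t'.
    apply/eqP; rewrite eq_le (coll_last (evP reg _) c' ai)/=.
    exact: (coll_last (evP reg _) c ai').
  by apply: nt c _; rewrite tt.
have fI : involutive f.
  move=> i; have [t c] := hf i; have [t' c'] := hf (f i).
  by apply: val_inj; apply: same c' (coll_sym c).
have fne i : f i != i by have [t [ij _ _ _]] := hf i; rewrite eq_sym.
have := @odd_card_fixfree_involution _ f [set: 'I_n.+1] fI fne.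
by rewrite cardsT card_ord /= negbK; apply => x; rewrite !inE.
Qed.

(** After [tau p.+1], as long as a bullet of the pair is active, so is [p.+1], which nothing fired
    later can reach because even the line of speed [w0] is not hit. So the pair evolves by itself,
    and neither of its bullets reaches the line of speed [u]. *)
Lemma pair_not_hits p (tau1 u w0 : R) : (0 < p)%N -> tau1 < tau p -> v p <= u ->
  v p < w0 <= v p.+1 -> ~ hits (bullets_from p.+2) (tau p.+1) w0 ->
  ~ hits (bullets_from p.+2) tau1 u -> ~ hits (bullets_from p) tau1 u.
Proof.
move=> p0 tp vu /andP[pw wq] nw nu.
have vp0 := regular_gt0 reg p0; have u0 : 0 < u by exact: lt_le_trans vu.
set I := bullets_between p p.+1; set K := bullets_from p.+2.
have E : bullets_from p = I `|` K.
  by rewrite (upto_after (bullets_from p) p.+1) upto_from after_from//; lia.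
have Iq s i : ev I s i -> i = p \/ i = p.+1.
  by move=> /(evol_mem (evP reg _)) /andP[h1 h2]; lia.
(* The only possible collision within the pair involves both bullets, so [p] is not active without
   [p.+1] once the latter has been fired. *)
have alive s i : tau p.+1 <= s -> ev I s i -> ev I s p.+1 /\ pos p.+1 s <= pos i s.
  move=> qs ai; have [ip|iq] := Iq _ _ ai; last by rewrite -iq.
  rewrite ip in ai *; suff aq : ev I s p.+1.
    by split => //; have := evol_order reg (evP reg _) (ltnSn p) ai aq.
  apply/(evP reg); split => //; first by apply/andP; split => //; lia.
  move=> r l rs c; have [ql _ al _] := c.
  have [lp|lq] := Iq _ _ al; last by move: ql; rewrite lq eqxx.
  rewrite lp in c; have := coll_last (evP reg _) (coll_sym c) ai.
  by rewrite leNgt rs.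
have EU : forall t i, ev (I `|` K) t i <-> ev I t i \/ ev K t i.
  apply: (ev_union reg).
    by move=> i [/andP[_ h1] h2]; move: h2; rewrite /K /bullets_from/=; lia.
  move=> s i j ai aj e; have Kj := evol_mem (evP reg _) aj.
  have js := evol_fired (evP reg _) aj.
  have qj : tau p.+1 < tau j by exact: mono.
  have [aq qi] := alive s i (ltW (lt_le_trans qj js)) ai.
  apply: nw; apply: (hits_mono reg _ (lexx _) wq).
  - by rewrite ltW// (lt_trans vp0).
  - by move=> l /= pl; exact/ltW/mono.
  have [] := @line_cross _ (v j) (tau j) (v p.+1) (tau p.+1) (tau j) s js.
  - by rewrite subrr mulr0 mulr_ge0// subr_ge0 ltW.
  - by rewrite -/(pos p.+1 s) -/(pos j s) -e.
  - move=> r [jr rs er]; exists r, j; split => //.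
    exact: evol_before (evP reg _) aj jr rs.
rewrite E => -[s [j [/EU[aj|aj] e]]]; last by apply: nu; exists s, j.
have behind : ev I s p -> pos p s < u * (s - tau1).
  by move=> /(evol_fired (evP reg _)); rewrite /pos; nra.
have js := evol_fired (evP reg _) aj.
have [jp|jq] := Iq _ _ aj; first by rewrite jp in aj e; have := behind aj; lra.
rewrite jq in aj e js.
(* Bullet [p] can only collide with [p.+1], so it is active as long as [p.+1] is, ahead of it and
   behind the line of speed [u]. *)
suff ap : ev I s p.
  by have := behind ap; have := evol_order reg (evP reg _) (ltnSn p) ap aj; lra.
apply/(evP reg); split => //; first by apply/andP; split => //; lia.
  by apply: le_trans js; exact/ltW/mono.
move=> r l rs c; have [pl _ al _] := c.
have [lp|lq] := Iq _ _ al; first by move: pl; rewrite lp eqxx.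
rewrite lq in c; have := coll_last (evP reg _) (coll_sym c) aj.
by rewrite leNgt rs.
Qed.

(* The bullets [a + 2i + 1] (slow) and [a + 2i + 2] (fast) annihilate each other
   before anything fired later can interfere. *)
Lemma pairs_not_hits m a (tau1 u w0 : R) : tau1 <= tau a -> u < w0 ->
  (forall i, (i < m)%N -> v (a + i.*2).+1 <= u /\ w0 <= v (a + i.*2).+2) ->
  ~ hits (bullets_from (a + m.*2).+1) (tau (a + m.*2)) w0 ->
  ~ hits (bullets_from (a + m.*2).+1) tau1 u ->
  ~ hits (bullets_from a.+1) (tau a) w0 /\ ~ hits (bullets_from a.+1) tau1 u.
Proof.
move=> + uw; elim: m a => [|m IH] a ta hv nw nu; first by rewrite double0 addn0 in nw nu.
have [] := IH a.+2.
- by apply: (le_trans ta); apply: (regular_le reg); lia.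
- by move=> i im; have := hv i.+1; rewrite ltnS => /(_ im); rewrite doubleS !addnS !addSn.
- by move: nw; rewrite doubleS !addnS !addSn.
- by move: nu; rewrite doubleS !addnS !addSn.
have [vp vq] := hv 0 (ltn0Sn _); rewrite double0 addn0 in vp vq.
move=> nw' nu'; split.
(* The line of speed [w0] leaving at [tau a] is handled as an instance of the slow line, with
   [u := w0]. *)
- apply: (@pair_not_hits a.+1 _ w0 w0) => //.
  + exact: mono.
  + by rewrite (le_trans vp)// ltW.
  + by rewrite (le_lt_trans vp uw).
  + move=> h; apply: nw'; apply: (hits_mono reg _ _ (lexx _) _ h).
    * by apply: le_trans (ltW uw); apply: le_trans vp; exact: ge0.
    * exact/ltW/mono/ltnW.
    * by move=> j /= aj; exact/ltW/mono.
- apply: (@pair_not_hits a.+1 _ u w0) => //.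
  + by apply: le_lt_trans ta _; exact: mono.
  + by rewrite (le_lt_trans vp uw).
Qed.

(** The [m] bullets fired next are no faster than the first ones and never catch them, and bullets
    beyond [n + m] are not fired by time [t]. *)
Lemma triple_extends n m t i j : (forall i j, (i <= n)%N -> (n < j <= n + m)%N -> v j <= v i) ->
  t < tau (n + m)%N ->
  coll (ev (bullets_between 0 n)) t i j -> coll (ev (bullets_from 0)) t i j.
Proof.
move=> vle tm c.
set I := bullets_between 0 n; set K := bullets_between n.+1 (n + m).
have E : bullets_between 0 (n + m) = I `|` K.
  rewrite (upto_after (bullets_between 0 (n + m)) n) upto_between ?leq_addr//.
  by rewrite after_between.
have EU : forall t i, ev (I `|` K) t i <-> ev I t i \/ ev K t i.
  apply: (ev_union reg) => [l [/andP[_ h1] /andP[h2 _]]|s k l ak al e]; first by lia.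
  have /andP[_ kn] := evol_mem (evP reg _) ak.
  have /andP[nl lm] := evol_mem (evP reg _) al.
  have js := evol_fired (evP reg _) al.
  have kl : tau k < tau l by apply: mono; lia.
  have := vle k l kn; rewrite nl lm => /(_ isT).
  have : 0 < v l by apply: (regular_gt0 reg); lia.
  by move: e; rewrite /pos; nra.
have ag l : tau l <= t -> bullets_between 0 (n + m) l <-> bullets_from 0 l.
  move=> lT; split=> // _; apply/andP; split => //.
  rewrite leqNgt; apply/negP => nl.
  by have := regular_le reg (ltnW nl); lra.
have tr l : ev I t l -> ev (bullets_from 0) t l.
  by move=> al; apply/(ev_agree reg ag _ (lexx _)); rewrite E; apply/EU; left.
by case: c => ij /tr ai /tr aj e.
Qed.

(** In a collision the later bullet is strictly faster and takes the lead only afterwards; if its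
    line is ahead at [S], the collision is past. *)
Lemma coll_before A t i j (S : R) J : evol v tau J A -> coll A t i j -> (i < j)%N ->
  (v i < v j -> pos i S < pos j S) -> t < S.
Proof.
move=> eA [_ ai aj e] ij h; have jt := evol_fired eA aj; have tij := mono ij.
have vj : 0 < v j by apply: (regular_gt0 reg); lia.
have vij : v i < v j by rewrite ltNge; apply/negP => vji; move: e; rewrite /pos; nra.
by have := h vij; move: e; rewrite /pos; nra.
Qed.

End Transience.

(** * Measurability of the collision events *)

Section Consistency.
Variables (R : realType) (v tau : nat -> R).
Hypothesis reg : regular v tau.
Let mono := regular_mono reg.
Let ge0 := regular_ge0 reg.

Local Notation ev := (ev v tau).
Local Notation surv := (surv v tau).
Local Notation pos := (pos v tau).
Local Notation coll := (coll v tau).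

Definition collide_in J i j : Prop := exists t, coll (ev J) t i j.

(** For distinct bullets of a regular configuration, this decides whether the trajectories ever
    meet: the later one has to be strictly faster. *)
Definition crosses i j : bool := if (i < j)%N then v i < v j else v j < v i.

(* Only meaningful if [crosses i j]; it is [0] if [v i = v j]. *)
Definition meeting_time i j : R := (v j * tau j - v i * tau i) / (v j - v i).

(* [C] is a guess at the pairs of colliding bullets.  Only countably many guesses
   are possible for finitely many bullets and exactly one is consistent, which
   makes the collision events measurable. *)
Definition consistent (J : set nat) (C : rel nat) : Prop := forall i j, C i j <->
  [/\ J i, J j, i != j, crosses i j &
      forall k, (C i k -> meeting_time i j <= meeting_time i k) /\
                (C j k -> meeting_time i j <= meeting_time j k)].

Lemma meeting_timeC i j : meeting_time i j = meeting_time j i.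
Proof. by rewrite /meeting_time -mulrNN -invrN !opprB. Qed.

Lemma crosses_neq i j : crosses i j -> v j - v i != 0.
Proof. by rewrite /crosses subr_eq0; case: ifP => _ h; [rewrite gt_eqF|rewrite lt_eqF]. Qed.

Lemma crosses_pos i j : crosses i j -> pos i (meeting_time i j) = pos j (meeting_time i j).
Proof. by move=> /crosses_neq h; rewrite /pos /meeting_time; field. Qed.

Lemma crosses_sym i j : i != j -> crosses i j -> crosses j i.
Proof. by rewrite /crosses; case: ltngtP. Qed.

Lemma crosses_fired2 i j : (i < j)%N -> crosses i j -> tau j <= meeting_time i j.
Proof.
move=> ij; rewrite /crosses ij => vij; have tij := mono ij.
rewrite /meeting_time ler_pdivlMr ?subr_gt0//; have := ge0 i; nra.
Qed.

Lemma crosses_fired i j : i != j -> crosses i j -> tau i <= meeting_time i j.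
Proof.
move=> /[dup] nij; rewrite neq_ltn => /orP[ij|ji] m.
  by apply: le_trans (crosses_fired2 ij m); exact/ltW/mono.
by rewrite meeting_timeC; apply: crosses_fired2 => //; exact: crosses_sym.
Qed.

Lemma same_pos_crosses i j s : i != j -> tau i <= s -> tau j <= s -> pos i s = pos j s ->
  crosses i j /\ s = meeting_time i j.
Proof.
move=> nij ti tj e.
have m : crosses i j.
  rewrite /crosses; move: nij; rewrite neq_ltn => /orP[ij|ji].
    rewrite ij ltNge; apply/negP => vji; have := mono ij.
    have : 0 < v j by apply: (regular_gt0 reg); lia.
    by move: e; rewrite /pos; nra.
  rewrite ltnNge (ltnW ji) /= ltNge; apply/negP => vji; have := mono ji.
  have : 0 < v i by apply: (regular_gt0 reg); lia.
  by move: e; rewrite /pos; nra.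
split => //; apply: (canRL (mulfK (crosses_neq m))).
by move: e; rewrite /pos; lra.
Qed.

Lemma coll_crosses J A s i j : evol v tau J A -> coll A s i j -> crosses i j /\ s = meeting_time i j.
Proof.
by move=> eA [ij ai aj e]; apply: same_pos_crosses => //; exact: (evol_fired eA).
Qed.

Lemma consistent_collide J (C : rel nat) : (forall i j, C i j <-> collide_in J i j) ->
  consistent J C.
Proof.
move=> CE i j; rewrite CE; split.
- move=> [s c]; have [m sE] := coll_crosses (evP reg J) c; have [ij ai aj e] := c.
  split => //; [exact: evol_mem (evP reg J) ai|exact: evol_mem (evP reg J) aj|move=> k].
  split=> /CE[s' c']; have [_ s'E] := coll_crosses (evP reg J) c'; rewrite -sE -s'E.
    exact: (coll_last (evP reg J) c' ai).
  exact: (coll_last (evP reg J) c' aj).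
- move=> [Ji Jj ij m h]; have mj := crosses_sym ij m; have ji : j != i by rewrite eq_sym.
  exists (meeting_time i j); split => //; last exact: crosses_pos.
    apply/(evP reg); split => //; first exact: crosses_fired.
    move=> r k rs c; have [_ rE] := coll_crosses (evP reg J) c.
    have [/(_ _)] := h k; rewrite CE -rE => /(_ (ex_intro (fun t => coll (ev J) t _ k) r c)); lra.
  apply/(evP reg); split => //; first by rewrite meeting_timeC; exact: crosses_fired.
  move=> r k rs c; have [_ rE] := coll_crosses (evP reg J) c.
  have [_ /(_ _)] := h k; rewrite CE -rE => /(_ (ex_intro (fun t => coll (ev J) t _ k) r c)); lra.
Qed.

(** A consistent [C] defines an evolution in which each bullet is active until its first guessed
    meeting; uniqueness of the evolution identifies [C] with the true collisions. *)
Lemma consistentP J (C : rel nat) : consistent J C -> forall i j, C i j <-> collide_in J i j.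
Proof.
move=> CC; pose A t := [set i | [/\ J i, tau i <= t & forall k, C i k -> t <= meeting_time i k]].
have Csym i j : C i j -> C j i.
  move=> /CC[Ji Jj ij m h]; apply/CC; split => //; first by rewrite eq_sym.
    exact: crosses_sym.
  by move=> k; have [h1 h2] := h k; rewrite meeting_timeC; split.
have CA i j : C i j -> A (meeting_time i j) i.
  move=> c; have /CC[Ji _ ij m h] := c.
  by split => //; [exact: crosses_fired|move=> k; have [] := h k].
have AC s i j : coll A s i j -> C i j /\ s = meeting_time i j.
  move=> [ij [Ji it hi] [Jj jt hj] e].
  have [m sE] := same_pos_crosses ij it jt e; split => //.
  by apply/CC; split => // k; rewrite -sE; split; [exact: hi|exact: hj].
have eA : evol v tau J A.
  move=> t i; split.
  - move=> ai; have [Ji it h] := ai; split => // s j st /AC[c sE].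
    by have := h j c; lra.
  - move=> [Ji it nc]; split => // k c; rewrite leNgt; apply/negP => st.
    have /CC[_ _ ik m _] := c; apply: (nc _ k st); split => //.
    + exact: CA.
    + by rewrite meeting_timeC; apply: CA; exact: Csym.
    + exact: crosses_pos.
move=> i j; rewrite /collide_in -(ev_unique reg eA); split=> [c|[s /AC[]//]].
have /CC[_ _ ij m _] := c.
exists (meeting_time i j); split => //; [exact: CA| |exact: crosses_pos].
by rewrite meeting_timeC; apply: CA; exact: Csym.
Qed.

(** With finitely many bullets the collision relation is a finite list of pairs, so the existential
    ranges over a countable type. *)
Lemma collide_in_consistent J N : (forall i, J i -> (i < N)%N) ->
  forall i j, collide_in J i j <->
    exists l : seq (nat * nat), consistent J (fun i j => (i, j) \in l) /\ (i, j) \in l.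
Proof.
move=> JN i j; split=> [c|[l [/consistentP h]]]; last by move/h.
pose l := [seq p <- [seq (i, j) | i <- iota 0 N, j <- iota 0 N] | `[< collide_in J p.1 p.2 >]].
have lE i' j' : (i', j') \in l <-> collide_in J i' j'.
  rewrite mem_filter; split=> [/andP[/asboolP//]|h]; apply/andP; split; first exact/asboolP.
  have [t [_ ai aj _]] := h.
  apply/allpairsP; exists (i', j'); rewrite !mem_iota !add0n /=; split => //; apply: JN.
    exact: evol_mem (evP reg _) ai.
  exact: evol_mem (evP reg _) aj.
exists l; split; last exact/lE.
exact: consistent_collide.
Qed.

(** Conversely, [i] and [j] can only collide at [meeting_time i j], whatever the truncation, so one
    truncation covering that time decides. *)
Lemma collide_in_upto J i j : collide_in J i j <->
  exists N, forall n, (N <= n)%N -> collide_in (upto J n) i j.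
Proof.
have ag s N n t k : s < tau N -> (N <= n)%N -> t <= s -> ev J t k <-> ev (upto J n) t k.
  move=> sN Nn ts; apply: (ev_agree reg _ _ ts) => l ls; split=> [Jl|[]//]; split => //=.
  rewrite leqNgt; apply/negP => nl.
  by have := regular_le reg (ltnW (leq_ltn_trans Nn nl)); lra.
split=> [[s [ij ai aj e]]|[N hN]].
- have [N sN] := regular_unbounded reg s; exists N => n Nn; exists s; split => //.
    by apply/(ag s N n).
  by apply/(ag s N n).
- have [M sM] := regular_unbounded reg (meeting_time i j).
  have [s c] := hN (maxn N M) (leq_maxl _ _).
  have [_ sE] := coll_crosses (evP reg _) c.
  have [ij ai aj e] := c; exists s; split => //.
    by apply/(ag s M (maxn N M)); rewrite ?leq_maxr// sE.
  by apply/(ag s M (maxn N M)); rewrite ?leq_maxr// sE.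
Qed.

Lemma survE J i : surv J i <-> J i /\ forall j, ~ collide_in J i j.
Proof.
rewrite (survP reg); split=> -[Ji h]; split => // j; first by move=> [s]; exact: h.
by move=> k c; apply: (h k); exists j.
Qed.

End Consistency.

(** * The product sigma-algebra on sequences *)

Section SequenceSpace.
Context {d : measure_display} (S : measurableType d).

Definition cylinder : set (set (nat -> S)) := [set A | exists n (E : nat -> set S),
  [/\ forall i, measurable (E i), forall i, (n <= i)%N -> E i = setT &
      A = [set x | forall i, E i (x i)]]].

Definition seq_space : Type := g_sigma_algebraType cylinder.
HB.instance Definition _ := Measurable.on seq_space.

Lemma seq_space_measurableE : @measurable _ seq_space = <<s cylinder >>.
Proof. by []. Qed.

Lemma cylinder_setI : setI_closed cylinder.
Proof.
move=> _ _ [n [E [mE hE ->]]] [m [F [mF hF ->]]].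
exists (maxn n m), (fun i => E i `&` F i); split.
- by move=> i; exact: measurableI.
- by move=> i; rewrite geq_max => /andP[ni mi]; rewrite hE// hF// setTI.
- apply/seteqP; split=> x; first by move=> [h1 h2] i; split.
  by move=> h; split=> i; case: (h i).
Qed.

Lemma cylinder_setT : cylinder setT.
Proof. by exists 0%N, (fun=> setT); split => //; apply/seteqP; split. Qed.

Lemma measurable_coordinate i : measurable_fun setT (fun x : seq_space => x i).
Proof.
move=> _ A mA; rewrite setTI; apply: sub_sigma_algebra.
exists i.+1, (fun j => if j == i then A else setT); split.
- by move=> j; case: ifP.
- by move=> j; case: eqP => // ->; rewrite ltnn.
- apply/seteqP; split=> x /= h; first by move=> j; case: eqP => // ->.
  by have := h i; rewrite eqxx.
Qed.

Lemma measurable_seq_space d' (T : measurableType d') (f : T -> seq_space) :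
  (forall i, measurable_fun setT (fun x => f x i)) -> measurable_fun setT f.
Proof.
move=> mf; apply: (@measurability _ _ T seq_space setT f cylinder) => //.
move=> _ [_ [n [E [mE _ ->]]] <-].
rewrite setTI (_ : _ @^-1` _ = \bigcap_i ((fun x => f x i) @^-1` E i)); last first.
  by apply/seteqP; split=> x h i; [move=> _; exact: h|exact: (h i Logic.I)].
by apply: bigcap_measurable => // i _; rewrite -[X in measurable X]setTI; exact: mf.
Qed.

Definition skip (k : nat) (x : seq_space) : seq_space := fun i => x (k + i)%N.

(** Preimages under [truncate a k] represent the events determined by the first [k] terms, preimages
    under [skip k] those determined by the other terms. *)
Definition truncate (a : S) (k : nat) (x : seq_space) : seq_space :=
  fun i => if (i < k)%N then x i else a.

Definition front (a : S) (x : seq_space) : seq_space :=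
  fun i => if i is i'.+1 then x i' else a.

Lemma measurable_skip k : measurable_fun setT (skip k).
Proof. by apply: measurable_seq_space => i; exact: measurable_coordinate. Qed.

Lemma measurable_truncate a k : measurable_fun setT (truncate a k).
Proof.
apply: measurable_seq_space => i; rewrite /truncate.
by case: (i < k)%N; [exact: measurable_coordinate|exact: measurable_cst].
Qed.

Lemma measurable_front a : measurable_fun setT (front a).
Proof.
apply: measurable_seq_space => -[|i]; [exact: measurable_cst|exact: measurable_coordinate].
Qed.

(** The pi-lambda argument for image measures. Two different source measures are allowed because
    independence compares a restriction of [P] with a multiple of [P]. *)
Lemma seq_space_measure_unique (R : realType) d1 d2 (T1 : measurableType d1)
  (T2 : measurableType d2) (m1 : {measure set T1 -> \bar R}) (m2 : {measure set T2 -> \bar R})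
  (f1 : T1 -> seq_space) (f2 : T2 -> seq_space) :
  measurable_fun setT f1 -> measurable_fun setT f2 -> (m1 setT < +oo)%E ->
  (forall A, cylinder A -> m1 (f1 @^-1` A) = m2 (f2 @^-1` A)) ->
  forall A : set seq_space, measurable A -> m1 (f1 @^-1` A) = m2 (f2 @^-1` A).
Proof.
move=> mf1 mf2 m1oo m12 A mA.
have cover : \bigcup_(k : nat) [set: seq_space] = setT.
  by apply/seteqP; split => // x _; exists 0%N.
exact: (@measure_unique _ R seq_space cylinder (fun=> setT) seq_space_measurableE cylinder_setI
  (fun=> cylinder_setT) cover
  (measure_function_pushforward__canonical__measure_function_Measure m1 mf1)
  (measure_function_pushforward__canonical__measure_function_Measure m2 mf2)
  m12 (fun=> m1oo) A mA).
Qed.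

Lemma measurable_preimage d' (T : measurableType d') d'' (T' : measurableType d'')
  (f : T -> T') A : measurable_fun setT f -> measurable A -> measurable (f @^-1` A).
Proof. by move=> mf mA; rewrite -[X in measurable X]setTI; exact: mf. Qed.

End SequenceSpace.

(** * Stationarity and independence of i.i.d. sequences *)

Section IidSequence.
Context {d d' : measure_display} {T : measurableType d} {S : measurableType d'} {R : realType}.
Variables (P : probability T R) (X : nat -> {RV P >-> S}).
Hypothesis indep : mutually_independent X.
Hypothesis ident : forall i E, measurable E -> P (X i @^-1` E) = P (X 0 @^-1` E).

Local Notation Om := (seq_space S).

Definition sample_path (w : T) : Om := config X w.

Lemma measurable_sample_path : measurable_fun setT sample_path.
Proof. by apply: measurable_seq_space => i; exact: measurable_funPT. Qed.

Definition path_law (A : set Om) : \bar R := P (sample_path @^-1` A).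

Lemma cylinder_prob k n (E : nat -> set S) : (forall i, measurable (E i)) ->
  (forall i, (n <= i)%N -> E i = setT) ->
  P [set w | forall i, E i (X (k + i)%N w)] = (\prod_(0 <= i < n) P (X 0 @^-1` E i))%E.
Proof.
move=> mE hE; pose F i := E (i - k)%N.
have u : uniq [seq (k + i)%N | i <- iota 0 n].
  by rewrite map_inj_uniq ?iota_uniq//; exact: addnI.
have := @indep [seq (k + i)%N | i <- iota 0 n] F u (fun=> mE _).
rewrite big_map => e; rewrite (_ : [set w | _] = \bigcap_(i in [set` [seq (k + i)%N | i <- iota 0 n]]) X i @^-1` F i).
  rewrite e /index_iota subn0; apply: eq_bigr => i _.
  by rewrite /F addKn ident.
apply/seteqP; split=> w h.
  by move=> _ /mapP[i _ ->]; rewrite /preimage/= /F addKn.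
move=> i; case: (ltnP i n) => [iN|/hE->//].
have := h (k + i)%N; rewrite /= /F /preimage/= addKn; apply; apply/mapP; exists i => //.
by rewrite mem_iota.
Qed.

Lemma measurable_sample_path_skip k : measurable_fun setT (skip k \o sample_path : T -> Om).
Proof. exact (measurableT_comp (measurable_skip k) measurable_sample_path). Qed.

Lemma law_skip k A : measurable A -> path_law (skip k @^-1` A) = path_law A.
Proof.
move: A; apply: (seq_space_measure_unique (measurable_sample_path_skip k) measurable_sample_path).
  exact: (le_lt_trans (probability_le1 P measurableT) (ltry 1)).
move=> _ [n [E [mE hE ->]]].
have e0 := cylinder_prob 0 mE hE; have ek := cylinder_prob k mE hE.
exact: etrans ek (esym e0).
Qed.

Lemma law_truncate_cylinder a k n E n' E' :
  (forall i, measurable (E i)) -> (forall i, (n <= i)%N -> E i = setT) ->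
  (forall i, measurable (E' i)) -> (forall i, (n' <= i)%N -> E' i = setT) ->
  path_law ((truncate a k @^-1` [set x | forall i, E i (x i)]) `&`
     (skip k @^-1` [set x | forall i, E' i (x i)])) =
  (path_law (truncate a k @^-1` [set x | forall i, E i (x i)]) *
   path_law [set x | forall i, E' i (x i)])%E.
Proof.
move=> mE hE mE' hE'.
(* From [k] on the truncated sequence is constantly [a]; if [a] violates one of the constraints
   there, both sides vanish. *)
have [ca|nca] := pselect (forall i, (k <= i)%N -> E i a); last first.
  have E0 : truncate a k @^-1` [set x | forall i, E i (x i)] = set0.
    apply/seteqP; split=> x //= h; apply: nca => i ki; have := h i.
    by rewrite /truncate ltnNge ki.
  by rewrite E0 set0I /path_law preimage_set0 measure0 mul0e.
pose F i := if (i < k)%N then E i else setT.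
pose G i := if (i < k)%N then E i else E' (i - k)%N.
have mF i : measurable (F i) by rewrite /F; case: ifP.
have mG i : measurable (G i) by rewrite /G; case: ifP.
have hF i : (k <= i)%N -> F i = setT by rewrite /F ltnNge => ->.
have hG i : (k + n' <= i)%N -> G i = setT.
  by move=> h; rewrite /G ltnNge (leq_trans _ h) ?leq_addr//= hE'// leq_subRL ?(leq_trans _ h)// leq_addr.
have -> : truncate a k @^-1` [set x | forall i, E i (x i)] = [set x | forall i, F i (x i)].
  apply/seteqP; split=> x h i; have := h i; rewrite /F /truncate /preimage/=.
    by case: ifP.
  by case: ltnP => // ki _; exact: ca.
have -> : [set x | forall i, F i (x i)] `&` (skip k @^-1` [set x | forall i, E' i (x i)]) =
    [set x : Om | forall i, G i (x i)].
  apply/seteqP; split=> x.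
    move=> [h h'] i; have := h i; have := h' (i - k)%N; rewrite /F /G /skip.
    by case: ltnP => // ki; rewrite subnKC.
  move=> h; split=> i; first by have := h i; rewrite /F /G; case: ifP.
  by have := h (k + i)%N; rewrite /G addKn ltnNge leq_addr.
have e1 := cylinder_prob 0 mG hG; have e2 := cylinder_prob 0 mF hF.
have e3 := cylinder_prob 0 mE' hE'.
rewrite /path_law [LHS]e1 [X in (X * _)%E]e2 [X in (_ * X)%E]e3.
rewrite (big_cat_nat (leq0n k) (leq_addr n' k))/=; congr (_ * _)%E.
  by rewrite !big_nat; apply: eq_bigr => i /andP[_ ik]; rewrite /F /G ik.
rewrite -{1}[k]add0n big_addn addKn; apply: eq_bigr => i _.
by rewrite /G addnK ltnNge leq_addl.
Qed.

(** Extension from rectangles one factor at a time: for a rectangle [A] both sides are finite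
    measures in [B]; then, for fixed [B], in [A]. *)
Lemma law_indep a k A B : measurable A -> measurable B ->
  path_law ((truncate a k @^-1` A) `&` (skip k @^-1` B)) =
  (path_law (truncate a k @^-1` A) * path_law B)%E.
Proof.
move=> mA mB.
have mpre (C : set Om) : measurable C -> measurable (sample_path @^-1` C).
  exact: measurable_preimage measurable_sample_path.
have mtr C : measurable C -> measurable (truncate a k @^-1` C : set Om).
  exact: measurable_preimage (measurable_truncate a k).
have msh C : measurable C -> measurable (skip k @^-1` C : set Om).
  exact: measurable_preimage (measurable_skip k).
have mt : measurable_fun setT (truncate a k \o sample_path : T -> Om).
  exact (measurableT_comp (measurable_truncate a k) measurable_sample_path).
have lawE C : measurable C -> exists2 c : {nonneg R}, path_law C = c%:num%:E & (0 <= path_law C)%E.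
  move=> mC; have f : path_law C \is a fin_num by apply: fin_num_measure; exact: mpre.
  have p : (0 <= path_law C)%E by exact: measure_ge0.
  by exists (NngNum (fine_ge0 p)) => //=; rewrite fineK.
have step1 (C : set Om) : cylinder C ->
  path_law ((truncate a k @^-1` C) `&` (skip k @^-1` B)) = (path_law (truncate a k @^-1` C) * path_law B)%E.
  move=> [n [E [mE hE ->{C}]]]; set C := [set x | _].
  have mC : measurable (C : set Om) by apply: sub_sigma_algebra; exists n, E.
  have [c ce _] := lawE _ (mtr _ mC).
  rewrite ce setIC.
  refine (@seq_space_measure_unique _ S R _ _ T T
    (mrestr P (mpre _ (mtr _ mC))) (mscale c P) (skip k \o sample_path) sample_path
    (measurable_sample_path_skip k) measurable_sample_path _ _ B mB).
  - by rewrite /= /mrestr setTI -/(path_law _) ce ltry.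
  - move=> _ [n' [E' [mE' hE' ->]]].
    have := law_truncate_cylinder a k mE hE mE' hE'.
    by rewrite -/C ce setIC.
have [c ce _] := lawE _ mB.
rewrite ce muleC.
refine (@seq_space_measure_unique _ S R _ _ T T
    (mrestr P (mpre _ (msh _ mB))) (mscale c P) (truncate a k \o sample_path) (truncate a k \o sample_path)
    mt mt _ _ A mA).
- by rewrite /= /mrestr setTI -/(path_law _) law_skip// ce ltry.
- by move=> C /step1; rewrite ce muleC.
Qed.

End IidSequence.

(** * Measurability of sets given by formulas *)

Section MeasurableProp.
Context {d : measure_display} {T : measurableType d}.
Implicit Types Q : T -> Prop.

Lemma measurable_Prop (Q : Prop) : measurable [set _ : T | Q].
Proof.
have [q|nq] := pselect Q.
  by rewrite (_ : [set _ | Q] = setT)//; apply/seteqP; split.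
by rewrite (_ : [set _ | Q] = set0)//; apply/seteqP; split.
Qed.

Lemma measurable_not Q : measurable [set x | Q x] -> measurable [set x | ~ Q x].
Proof. exact: measurableC. Qed.

Lemma measurable_conj Q Q' : measurable [set x | Q x] -> measurable [set x | Q' x] ->
  measurable [set x | Q x /\ Q' x].
Proof. exact: measurableI. Qed.

Lemma measurable_imply Q Q' : measurable [set x | Q x] -> measurable [set x | Q' x] ->
  measurable [set x | Q x -> Q' x].
Proof.
move=> mQ mQ'; rewrite (_ : [set x | Q x -> Q' x] = ~` [set x | Q x] `|` [set x | Q' x]).
  by apply: measurableU => //; exact: measurableC.
apply/seteqP; split=> x /=; last by move=> [].
by have [q|] := pselect (Q x); [right; auto|left].
Qed.

Lemma measurable_iff Q Q' : measurable [set x | Q x] -> measurable [set x | Q' x] ->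
  measurable [set x | Q x <-> Q' x].
Proof. by move=> mQ mQ'; apply: measurable_conj; exact: measurable_imply. Qed.

Lemma measurable_forall (Q : nat -> T -> Prop) : (forall n, measurable [set x | Q n x]) ->
  measurable [set x | forall n, Q n x].
Proof.
move=> mQ; rewrite (_ : [set x | _] = \bigcap_n [set x | Q n x]).
  exact: bigcapT_measurable.
by apply/seteqP; split=> x h n; [move=> _; exact: h|exact: (h n Logic.I)].
Qed.

Lemma measurable_exists (I : countType) (Q : I -> T -> Prop) :
  (forall i, measurable [set x | Q i x]) -> measurable [set x | exists i, Q i x].
Proof.
move=> mQ; rewrite (_ : [set x | _] = \bigcup_i [set x | Q i x]).
  exact: countable_bigcupT_measurable.
by apply/seteqP; split=> x [i]; [exists i|move=> _; exists i].
Qed.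

Lemma measurable_lt_set (R : realType) (f g : T -> measurableTypeR R) : measurable_fun setT f ->
  measurable_fun setT g -> measurable [set x | (f x : R) < g x].
Proof.
move=> mf mg; have := measurable_fun_ltr mf mg measurableT (Y := [set true]) Logic.I.
by rewrite setTI; congr measurable; apply/seteqP; split.
Qed.

Lemma measurable_le_set (R : realType) (f g : T -> measurableTypeR R) : measurable_fun setT f ->
  measurable_fun setT g -> measurable [set x | (f x : R) <= g x].
Proof.
move=> mf mg; have := measurable_fun_ler mf mg measurableT (Y := [set true]) Logic.I.
by rewrite setTI; congr measurable; apply/seteqP; split.
Qed.

End MeasurableProp.

Lemma measurable_inv (R : realType) :
  measurable_fun setT (fun x : measurableTypeR R => (x^-1 : measurableTypeR R)).
Proof.
rewrite (_ : (fun x => _) = fun x : R => if x == 0 then 0 else x^-1); last first.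
  by apply/funext => x; case: eqP => // ->; rewrite invr0.
apply: measurable_fun_if => //=.
- by apply: measurable_fun_eqr => //; exact: measurable_cst.
- rewrite setTI (_ : _ @^-1` _ = [set x : R | x != 0]); last first.
    by apply/seteqP; split=> x /=; case: eqP.
  apply: open_continuous_measurable_fun.
    exact: open_neq.
  by move=> x; rewrite inE /= => x0; apply: continuousV.
Qed.

Section MeasurableCollisions.
Variable R : realType.

Local Notation S2 := (measurableTypeR R * measurableTypeR R)%type.
Local Notation Om := (seq_space S2).

Definition regular_config (x : Om) : Prop := regular (velocity x) (fire_time x 0).

Definition collides (x : Om) J i j : Prop := collide_in (velocity x) (fire_time x 0) J i j.

Lemma measurable_velocity i :
  measurable_fun setT (fun x : Om => velocity x i : measurableTypeR R).
Proof. exact: measurableT_comp measurable_fst (measurable_coordinate i). Qed.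

Lemma measurable_delay i :
  measurable_fun setT (fun x : Om => delay x i : measurableTypeR R).
Proof. exact: measurableT_comp measurable_snd (measurable_coordinate i). Qed.

Lemma measurable_fire_time i :
  measurable_fun setT (fun x : Om => fire_time x 0 i : measurableTypeR R).
Proof. by rewrite /fire_time; apply: measurable_sum => j; exact: measurable_delay. Qed.

Lemma measurable_meeting_time i j : measurable_fun setT
  (fun x : Om => meeting_time (velocity x) (fire_time x 0) i j : measurableTypeR R).
Proof.
rewrite /meeting_time; apply: measurable_funM.
  by apply: measurable_funB; apply: measurable_funM;
    do ?[exact: measurable_velocity|exact: measurable_fire_time].
apply: (measurableT_comp (@measurable_inv R)).
by apply: measurable_funB; exact: measurable_velocity.
Qed.

Lemma measurable_regular : measurable [set x : Om | regular_config x].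
Proof.
rewrite (_ : [set x | _] = [set x : Om |
  (forall i j, (i < j)%N -> fire_time x 0 i < fire_time x 0 j) /\
  (forall n, exists i, n%:R < fire_time x 0 i) /\
  (forall i, 0 <= velocity x i) /\ (forall i, (0 < i)%N -> 0 < velocity x i)]).
  apply: measurable_conj.
    apply: measurable_forall => i; apply: measurable_forall => j.
    apply: measurable_imply; first exact: measurable_Prop.
    by apply: measurable_lt_set; exact: measurable_fire_time.
  apply: measurable_conj.
    apply: measurable_forall => n; apply: measurable_exists => i.
    by apply: measurable_lt_set; [exact: measurable_cst|exact: measurable_fire_time].
  apply: measurable_conj.
    apply: measurable_forall => i.
    by apply: measurable_le_set; [exact: measurable_cst|exact: measurable_velocity].
  apply: measurable_forall => i; apply: measurable_imply; first exact: measurable_Prop.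
  by apply: measurable_lt_set; [exact: measurable_cst|exact: measurable_velocity].
apply/seteqP; split=> x.
  by move=> [h1 h2 h3 h4]; do ?split => //.
move=> [h1 [h2 [h3 h4]]]; split => // t.
have [i hi] := h2 (Num.bound `|t|); exists i; apply: le_lt_trans hi.
by rewrite (le_trans (ler_norm _))// ltW// archi_boundP.
Qed.

Lemma measurable_crosses i j : measurable [set x : Om | crosses (velocity x) i j].
Proof.
rewrite /crosses; case: (i < j)%N;
  by apply: measurable_lt_set; exact: measurable_velocity.
Qed.

(** For a fixed list, consistency is a countable conjunction of comparisons between measurable
    functions. Regularity stays in the event because only there are collisions characterised by
    consistent lists. *)
Lemma measurable_collides_finite J N i j : (forall i, J i -> (i < N)%N) ->
  measurable [set x : Om | regular_config x /\ collides x J i j].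
Proof.
move=> JN.
rewrite (_ : [set x | _] = [set x | regular_config x /\ exists l : seq (nat * nat),
    consistent (velocity x) (fire_time x 0) J (fun i j => (i, j) \in l) /\ (i, j) \in l]).
  apply: measurable_conj; first exact: measurable_regular.
  apply: measurable_exists => l; apply: measurable_conj; last exact: measurable_Prop.
  apply: measurable_forall => i'; apply: measurable_forall => j'.
  apply: measurable_iff; first exact: measurable_Prop.
  rewrite (_ : [set x | _] = [set x : Om | J i' /\ J j' /\ i' != j' /\ crosses (velocity x) i' j' /\
    forall k, ((i', k) \in l -> meeting_time (velocity x) (fire_time x 0) i' j' <=
        meeting_time (velocity x) (fire_time x 0) i' k) /\
      ((j', k) \in l -> meeting_time (velocity x) (fire_time x 0) i' j' <=
        meeting_time (velocity x) (fire_time x 0) j' k)]); last first.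
    by apply/seteqP; split=> x /=; [move=> []|move=> [? [? [? []]]]].
  do 3! (apply: measurable_conj; first exact: measurable_Prop).
  apply: measurable_conj; first exact: measurable_crosses.
  apply: measurable_forall => k; apply: measurable_conj;
    by (apply: measurable_imply; first exact: measurable_Prop);
       apply: measurable_le_set; exact: measurable_meeting_time.
apply/seteqP; split=> x [reg h]; split => //.
  exact/(collide_in_consistent reg JN i j).
exact/(collide_in_consistent reg JN i j).
Qed.

Lemma measurable_collides J i j :
  measurable [set x : Om | regular_config x /\ collides x J i j].
Proof.
rewrite (_ : [set x | _] = [set x : Om | regular_config x /\ exists N, forall n, (N <= n)%N ->
    regular_config x /\ collides x (upto J n) i j]).
  apply: measurable_conj; first exact: measurable_regular.
  apply: measurable_exists => N; apply: measurable_forall => n.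
  apply: measurable_imply; first exact: measurable_Prop.
  by apply: (@measurable_collides_finite _ n.+1) => k [_ /=]; rewrite ltnS.
apply/seteqP; split=> x [reg].
  by move=> /(collide_in_upto reg)[N h]; split => //; exists N => n Nn; split => //; exact: h.
by move=> [N h]; split => //; apply/(collide_in_upto reg); exists N => n /h[].
Qed.

Definition survivor (x : Om) J i : Prop := surv (velocity x) (fire_time x 0) J i.

Lemma measurable_survivor J i : measurable [set x : Om | regular_config x /\ survivor x J i].
Proof.
rewrite (_ : [set x | _] = [set x : Om | regular_config x /\ J i /\
    forall j, ~ (regular_config x /\ collides x J i j)]).
  apply: measurable_conj; first exact: measurable_regular.
  apply: measurable_conj; first exact: measurable_Prop.
  by apply: measurable_forall => j; apply: measurable_not; exact: measurable_collides.
apply/seteqP; split=> x [reg].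
  by move=> /(survE reg)[Ji h]; do 2!split => //; move=> j [_]; exact: h.
by move=> [Ji h]; split => //; apply/(survE reg); split => // j c; apply: (h j).
Qed.

End MeasurableCollisions.

(** * Shifted and modified configurations *)

Section Bridge.
Variable R : realType.

Local Notation S2 := (measurableTypeR R * measurableTypeR R)%type.
Local Notation Om := (seq_space S2).
Implicit Types (x g : Om) (J : set nat).

Definition bullet (v a : R) : S2 := (v, a).

(** The delay of bullet 0 is not seen by [fire_time x 0], but it becomes a true gap when another
    bullet is put in front. *)
Definition positive_config x : Prop :=
  [/\ forall i, 0 < velocity x i, forall i, 0 < delay x i &
      forall t : R, exists i, t < fire_time x 0 i].

Lemma fire_time0 x : fire_time x 0 0 = 0.
Proof. by rewrite /fire_time big_geq. Qed.

Lemma fire_timeS x n : fire_time x 0 n.+1 = fire_time x 0 n + delay x n.+1.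
Proof. by rewrite /fire_time big_nat_recr. Qed.

Lemma fire_timeD x k n : fire_time x 0 (k + n)%N = fire_time x 0 k + fire_time (skip k x) 0 n.
Proof.
elim: n => [|n IH]; first by rewrite addn0 fire_time0 addr0.
by rewrite addnS !fire_timeS IH -addrA /delay /skip addnS.
Qed.

Lemma fire_time_front x a n : fire_time (front a x) 0 n.+1 = delay x 0 + fire_time x 0 n.
Proof.
elim: n => [|n IH]; first by rewrite fire_timeS !fire_time0 addr0 add0r.
by rewrite fire_timeS IH fire_timeS addrA.
Qed.

Lemma regular_configP x : (forall i, 0 <= velocity x i) -> (forall i, (0 < i)%N -> 0 < velocity x i) ->
  (forall i, (0 < i)%N -> 0 < delay x i) -> (forall t : R, exists i, t < fire_time x 0 i) ->
  regular_config x.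
Proof.
move=> v0 vp dp unb; split => // i j.
elim: j => // j IH; rewrite ltnS leq_eqVlt => /predU1P[->|/IH ij]; rewrite fire_timeS.
  by have := dp j.+1 isT; lra.
by have := dp j.+1 isT; lra.
Qed.

Lemma positive_regular x : positive_config x -> regular_config x.
Proof. by move=> [v0 d0 unb]; apply: regular_configP => // i; exact/ltW. Qed.

Lemma positive_shift k x : positive_config x -> positive_config (skip k x).
Proof.
move=> [v0 d0 unb]; split=> [i|i|t]; [exact: v0|exact: d0|].
have [i hi] := unb (fire_time x 0 k + t).
exists i; have : fire_time x 0 i <= fire_time x 0 (k + i)%N.
  by apply: (regular_le (positive_regular (And3 v0 d0 unb))); exact: leq_addl.
by rewrite fire_timeD; lra.
Qed.

(** The filler [bullet 1 1] has unit delays, so the firing times remain unbounded. *)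
Lemma positive_truncate k x : positive_config x -> positive_config (truncate (bullet 1 1) k x).
Proof.
move=> [v0 d0 _]; split=> [i|i|t]; rewrite /velocity /delay /truncate.
- by case: ifP => // _; exact: v0.
- by case: ifP => // _; exact: d0.
have d1 i : 0 <= delay (truncate (bullet 1 1) k x) i.
  by rewrite /delay /truncate; case: ifP => // _; exact/ltW/d0.
have h n : n%:R <= fire_time (truncate (bullet 1 1) k x) 0 (k + n)%N.
  elim: n => [|n IH]; first by apply: sumr_ge0.
  rewrite addnS fire_timeS -natr1 lerD// /delay /truncate ltnNge.
  by rewrite leqW ?leq_addr.
exists (k + Num.bound `|t|)%N; apply: lt_le_trans (h _).
by rewrite (le_lt_trans (ler_norm _))// archi_boundP.
Qed.

Lemma positive_front (v : R) a x : 0 <= v -> positive_config x -> regular_config (front (bullet v a) x).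
Proof.
move=> v0 [vp dp unb]; apply: regular_configP.
- by move=> [|i] //; exact/ltW/vp.
- by move=> [|i] // _; exact: vp.
- by move=> [|i] // _; exact: dp.
- move=> t; have [i hi] := unb t; exists i.+1; rewrite fire_time_front.
  by have := dp 0%N; lra.
Qed.

Lemma survivesP x J i : regular_config x -> survives x 0 J i <-> survivor x J i.
Proof.
move=> reg; split.
- move=> [A [eA Ji np]]; apply/(survP reg); split => // s j c; apply: np.
  by exists s, j; rewrite /collide; have -> := ev_unique reg eA.
- move=> /(survP reg)[Ji nc]; exists (ev (velocity x) (fire_time x 0) J); split => //.
    exact: (evP reg J).
  by move=> [s [j c]]; exact: (nc s j).
Qed.

Lemma survivor_truncate k n i x : positive_config x -> (n < k)%N ->
  survivor (truncate (bullet 1 1) k x) (bullets_between 0 n) i <-> survivor x (bullets_between 0 n) i.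
Proof.
move=> px nk; rewrite /survivor.
apply: (@surv_shift _ _ _ _ _ _ _ 0 0) => //.
- by move=> j /andP[_ jn]; rewrite /velocity /truncate (leq_ltn_trans jn nk).
- move=> j /andP[_ jn]; rewrite subr0 add0n /fire_time; apply: eq_big_nat => l /andP[_ lj].
  by rewrite /delay /truncate (leq_ltn_trans _ nk)// (leq_trans _ jn).
- exact: positive_regular.
- exact/positive_regular/positive_truncate.
Qed.

Lemma last_survives_shift m n x : positive_config x ->
  last_survives (velocity (skip m x)) (fire_time (skip m x) 0) 0 n <->
  last_survives (velocity x) (fire_time x 0) m (m + n)%N.
Proof.
move=> px; apply: (@surv_shift _ _ _ _ _ _ _ m (fire_time x 0 m)).
- by move=> i; split=> /andP[h1 h2]; apply/andP; split; lia.
- by move=> j /andP[].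
- by [].
- by move=> i _; rewrite fire_timeD; ring.
- exact: positive_regular.
- exact/positive_regular/positive_shift.
Qed.

Lemma survivor_shift m i x : positive_config x ->
  survivor (skip m x) (bullets_from 0) i <-> survivor x (bullets_from m) (m + i)%N.
Proof.
move=> px; apply: (@surv_shift _ _ _ _ _ _ _ m (fire_time x 0 m)) => //.
- by move=> j; split => // _; exact: leq_addr.
- by move=> j _; rewrite fire_timeD; ring.
- exact: positive_regular.
- exact/positive_regular/positive_shift.
Qed.

Lemma hits_shift_config m x (t0 v0 : R) : positive_config x ->
  hits (velocity (skip m x)) (fire_time (skip m x) 0) (bullets_from 0) (t0 - fire_time x 0 m) v0 <->
  hits (velocity x) (fire_time x 0) (bullets_from m) t0 v0.
Proof.
move=> px; apply: (@hits_shift _ _ _ _ _ _ _ m) => //.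
- by move=> j; split => // _; exact: leq_addr.
- by move=> j _; rewrite fire_timeD; ring.
- exact: positive_regular.
- exact/positive_regular/positive_shift.
Qed.

(** In the clock of [x], which starts when its own first bullet is fired, the front bullet leaves at
    time [- delay x 0]. *)
Lemma front_survivor (v a : R) x : 0 <= v -> positive_config x ->
  survivor (front (bullet v a) x) (bullets_from 0) 0 <->
  ~ hits (velocity x) (fire_time x 0) (bullets_from 0) (- delay x 0) v.
Proof.
move=> v0 px; have regf := positive_front a v0 px; have regx := positive_regular px.
have hE : hits (velocity x) (fire_time x 0) (bullets_from 0) (- delay x 0) v <->
    hits (velocity (front (bullet v a) x)) (fire_time (front (bullet v a) x) 0) (bullets_from 1) 0 v.
  rewrite -(sub0r (delay x 0)).
  apply: (@hits_shift _ _ _ _ _ _ _ 1) => //.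
  by move=> j _; rewrite add1n fire_time_front; ring.
rewrite hE; split.
  by move=> /(surv_not_hit regf); rewrite after_from// fire_time0.
move=> nh; apply: (not_hit_surv regf); last by rewrite after_from// fire_time0.
rewrite upto_from; apply/(survP regf); split => // s j [nj _ aj _].
have /andP[_] := evol_mem (evP regf _) aj.
by rewrite leqn0 eq_sym (negbTE nj).
Qed.

(** Applied to [skip k.+1 x] this is the event [A_k] (see [escape_shift]). The delay 1 is a
    placeholder: the first bullet is fired at time 0 whatever its delay. *)
Definition escape (v : R) : set Om :=
  [set g | regular_config (front (bullet v 1) g) /\ survivor (front (bullet v 1) g) (bullets_from 0) 0].

Lemma escapeP v g : 0 <= v -> positive_config g -> escape v g <->
  ~ hits (velocity g) (fire_time g 0) (bullets_from 0) (- delay g 0) v.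
Proof.
move=> v0 pg; rewrite -(front_survivor 1 v0 pg); split=> [[]//|h]; split => //.
exact: positive_front.
Qed.

Lemma escape_shift v k x : 0 <= v -> positive_config x -> escape v (skip k.+1 x) <->
  ~ hits (velocity x) (fire_time x 0) (bullets_from k.+1) (fire_time x 0 k) v.
Proof.
move=> v0 px; rewrite escapeP//; last exact: positive_shift.
rewrite -(hits_shift_config k.+1 _ _ px).
rewrite (_ : fire_time x 0 k - _ = - delay (skip k.+1 x) 0)//.
by rewrite fire_timeS /skip /delay addn0; ring.
Qed.

Lemma with_first_speed_front x (v : R) : with_first_speed x v = front (bullet v (delay x 0)) (skip 1 x).
Proof. by apply/funext => -[|i]. Qed.

Lemma survives_with_first_speed v x : 0 <= v -> positive_config x ->
  survives (with_first_speed x v) 0 (bullets_from 0) 0 <-> escape v (skip 1 x).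
Proof.
move=> v0 px; rewrite with_first_speed_front; have ps := positive_shift 1 px.
rewrite survivesP; last exact: positive_front.
by rewrite front_survivor// escapeP.
Qed.

Lemma measurable_escape v : measurable (escape v : set Om).
Proof.
exact: measurable_preimage (measurable_front (bullet v 1)) (measurable_survivor (bullets_from 0) 0).
Qed.

(* In [front a x], the first delay of [x] separates the front bullet from the rest. *)
Definition reset_gap (D : R) (x : Om) : Om := fun i => if i == 0%N then (velocity x 0, D) else x i.

Lemma measurable_reset_gap D : measurable_fun setT (reset_gap D).
Proof.
apply: measurable_seq_space => i; rewrite /reset_gap; case: (i == 0%N).
  by apply: measurable_fun_pair; [exact: measurable_velocity|exact: measurable_cst].
exact: measurable_coordinate.
Qed.

(** Expresses escaping with a prescribed lead [D] as a preimage of [escape v], which makes it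
    measurable. *)
Lemma escape_reset_gap v D g : 0 <= v -> 0 < D -> positive_config g -> escape v (reset_gap D g) <->
  ~ hits (velocity g) (fire_time g 0) (bullets_from 0) (- D) v.
Proof.
move=> v0 D0 pg.
have vE : velocity (reset_gap D g) = velocity g by apply/funext => -[|i].
have tE : fire_time (reset_gap D g) 0 = fire_time g 0.
  apply/funext => i; rewrite /fire_time; apply: eq_big_nat => j /andP[j0 _].
  by case: j j0.
rewrite escapeP ?vE ?tE//; case: pg => vp dp unb; split => //.
- by move=> i; rewrite vE.
- by move=> [|i] //; exact: dp.
- by move=> t; rewrite tE.
Qed.

End Bridge.

(** * Independent bullets *)

Section AlmostSure.
Context {d : measure_display} {T : measurableType d} {R : realType} (P : probability T R).

Lemma ae_null (A : set T) : measurable A -> P A = 0%E <-> {ae P, forall w, ~ A w}.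
Proof.
move=> mA; rewrite -(negligibleP P mA).
by split; apply: negligibleS => w /=; [exact: contrapT|move=> Aw; apply].
Qed.

Lemma ae_forall (I : countType) (Q : I -> T -> Prop) :
  (forall i, {ae P, forall w, Q i w}) -> {ae P, forall w, forall i, Q i w}.
Proof.
move=> h; pose F n := if unpickle n is Some i then ~` [set w | Q i w] else set0.
have : P.-negligible (\bigcup_n F n).
  apply: negligible_bigcup => n; rewrite /F.
  by case: unpickle => [i|]; [exact: h|exact: negligible_set0].
apply: negligibleS => w /= nh; apply: contrapT => nF; apply: nh => i.
by apply: contrapT => nQ; apply: nF; exists (pickle i) => //; rewrite /F pickleK.
Qed.

Lemma ae_full (A : set T) : measurable A -> P A = 1%E -> {ae P, forall w, A w}.
Proof.
move=> mA A1; have : P.-negligible (~` A); last exact: negligibleS.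
apply/negligibleP; first exact: measurableC.
by have := probability_setC P mA; rewrite A1 subee.
Qed.

(** Replaces a random index by a fixed one: countably many null events cannot cover an event of
    positive probability. *)
Lemma measure_gt0_exists (I : countType) (A : set T) (B : I -> set T) :
  measurable A -> (forall i, measurable (B i)) ->
  {ae P, forall w, A w -> exists i, B i w} -> (0 < P A)%E -> exists i, (0 < P (B i))%E.
Proof.
move=> mA mB AB; apply: contraPP => nB.
have B0 i : {ae P, forall w, ~ B i w}.
  apply/ae_null => //; apply/eqP; rewrite eq_le measure_ge0 andbT leNgt.
  by apply/negP => h; apply: nB; exists i.
have /ae_null -> // : {ae P, forall w, ~ A w}.
  by apply: filterS2 AB (ae_forall B0) => w AB nBw /AB[i]; exact: nBw.
by rewrite ltxx.
Qed.

Lemma measure_gt0_sub (A B : set T) : measurable A -> measurable B ->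
  {ae P, forall w, A w -> B w} -> (0 < P A)%E -> (0 < P B)%E.
Proof.
move=> mA mB AB A0.
by have [] := @measure_gt0_exists unit A (fun=> B) mA (fun=> mB) _ A0;
  [apply: filterS AB => w h /h; exists tt|move=> _].
Qed.

End AlmostSure.

(** * Countable families of levels with positive mass beyond them *)

Section Coinitial.
Variable R : realType.

Lemma countable_coinitial (I : set R) : I !=set0 ->
  exists s : nat -> R, (forall k, I (s k)) /\ forall x, I x -> exists k, s k <= x.
Proof.
move=> [x0 Ix0].
(* For each rational that dominates an element of [I], such an element is chosen; without a minimum,
   a rational lies between any element and some smaller one. *)
have /choice[f hf] (q : rat) : exists y, I y /\ ((exists2 z, I z & z <= ratr q) -> y <= ratr q).
  have [[z Iz zq]|n] := pselect (exists2 z, I z & z <= ratr q); first by exists z.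
  by exists x0.
have [[a Ia amin]|nomin] := pselect (exists2 a, I a & forall x, I x -> a <= x).
  by exists (fun=> a); split => // x /amin ax; exists 0%N.
exists (fun n => if unpickle n is Some q then f q else x0); split.
  by move=> k; case: unpickle => // q; case: (hf q).
move=> x Ix; have [y Iy yx] : exists2 y, I y & y < x.
  apply: contrapT => n; apply: nomin; exists x => // y Iy; rewrite leNgt.
  by apply/negP => yx; apply: n; exists y.
have [q] := rat_in_itvoo yx; rewrite in_itv/= => /andP[yq qx].
exists (pickle q); rewrite pickleK; have [_ h] := hf q.
by apply: le_trans (ltW qx); apply: h; exists y => //; exact: ltW.
Qed.

(** A point lying below all chosen levels of positive mass is itself a null level, and countably
    many null half-lines cover the null levels. *)
Lemma measure_coinitial (m : {measure set (measurableTypeR R) -> \bar R}) :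
  m setT = 1%E -> exists s : nat -> R, (forall k, (0 < m [set x | (x <= s k)%R])%E) /\
  m (~` [set x | exists k, s k <= x]) = 0%E.
Proof.
move=> m1.
have mle (a : R) : measurable [set x : measurableTypeR R | (x : R) <= a].
  by apply: measurable_le_set; [exact: measurable_id|exact: measurable_cst].
have mge (a : R) : measurable [set x : measurableTypeR R | a <= (x : R)].
  by apply: measurable_le_set; [exact: measurable_cst|exact: measurable_id].
pose I := [set u : R | (0 < m [set x | (x <= u)%R])%E].
(* The null levels, reflected so that [countable_coinitial] gives a cofinal sequence of them. *)
pose I' := [set u : R | m [set x | (x <= (- u)%R)%R] = 0%E].
have II' x : ~ I x -> I' (- x).
  by rewrite /I /I'/= opprK => /negP; rewrite -leNgt => h; apply/eqP; rewrite eq_le h measure_ge0.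
have null (N : nat -> set (measurableTypeR R)) : (forall n, measurable (N n)) -> (forall n, m (N n) = 0%E) ->
    m (\bigcup_n N n) = 0%E.
  move=> mN N0; apply: measure_negligible; first exact: bigcupT_measurable.
  by apply: negligible_bigcup => n; apply/(negligibleP m (mN n)); exact: N0.
have I0 : I !=set0.
  apply: contrapT => nI; have : m (\bigcup_n [set x | (x <= n%:R)%R]) = 0%E.
    apply: null => // n; apply/eqP; rewrite eq_le measure_ge0 andbT leNgt.
    by apply/negP => h; apply: nI; exists n%:R.
  rewrite (_ : \bigcup_n _ = setT) ?m1; first by move/eqP; rewrite onee_eq0.
  apply/seteqP; split => // x _; exists (Num.bound `|x|) => //=.
  by rewrite (le_trans (ler_norm _))// ltW// archi_boundP.
have [s [Is cs]] := countable_coinitial I0.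
exists s; split => //.
have mC : measurable (~` [set x : measurableTypeR R | exists k, s k <= (x : R)]).
  by apply: measurableC; apply: measurable_exists => k; exact: mge.
have [I'0|nI'] := pselect (I' !=set0); last first.
  rewrite (_ : ~` _ = set0) ?measure0//; apply/seteqP; split => // x /= nx.
  apply: nI'; exists (- x); apply: II' => /cs[k sk]; apply: nx; by exists k.
have [s' [Is' cs']] := countable_coinitial I'0.
apply: (@subset_measure0 _ _ _ m _ (\bigcup_n [set x | (x <= (- s' n)%R)%R])) => //.
- exact: bigcupT_measurable.
- move=> x /= nx; have /cs'[k sk] : I' (- x).
    by apply: II' => /cs[k sk]; apply: nx; exists k.
  by exists k => //=; rewrite lerNr.
- exact: null.
Qed.

Lemma measure_cofinal (m : {measure set (measurableTypeR R) -> \bar R}) :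
  m setT = 1%E -> exists s : nat -> R, (forall k, (0 < m [set x | (s k <= x)%R])%E) /\
  m (~` [set x | exists k, x <= s k]) = 0%E.
Proof.
move=> m1.
have mopp : measurable_fun setT (fun x : measurableTypeR R => (- x : measurableTypeR R)).
  exact: measurable_funN.
have [s [s0 sn]] := @measure_coinitial
  (measure_function_pushforward__canonical__measure_function_Measure m mopp) m1.
exists (fun k => - s k); split.
  move=> k; apply: (lt_le_trans (s0 k)); rewrite le_eqVlt; apply/orP; left; apply/eqP.
  by congr (m _); apply/seteqP; split=> x /=; rewrite lerNl.
rewrite -sn /=; congr (m _); apply/seteqP; split=> x /= nx [k sk]; apply: nx; exists k; lra.
Qed.

End Coinitial.

(** * The law of the bullet sequence *)

Section Bullets.
Context {R : realType} {d : measure_display} {T : measurableType d} (P : probability T R)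
  (mu nu : probability (measurableTypeR R) R)
  (b : nat -> {RV P >-> (measurableTypeR R * measurableTypeR R)%type}).
Hypotheses (mu_pos : mu [set x | 0 < x] = 1%E) (nu_pos : nu [set x | 0 < x] = 1%E).
Hypothesis b_iid : iid_bullets mu nu b.

Local Notation S2 := (measurableTypeR R * measurableTypeR R)%type.
Local Notation Om := (seq_space S2).
Local Notation X := (sample_path b).
Local Notation law := (path_law b).

Lemma bullets_ident i E : measurable E -> P (b i @^-1` E) = P (b 0 @^-1` E).
Proof. by move=> mE; have [_ h] := b_iid; exact: etrans (h i E mE) (esym (h 0 E mE)). Qed.

Let indep := b_iid.1.

Lemma law_skipE k (A : set Om) : measurable A -> law (skip k @^-1` A) = law A.
Proof. exact: law_skip indep bullets_ident k A. Qed.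

Lemma law_indepE k (A B : set Om) : measurable A -> measurable B ->
  law ((truncate (bullet 1 1) k @^-1` A) `&` (skip k @^-1` B)) =
  (law (truncate (bullet 1 1) k @^-1` A) * law B)%E.
Proof. exact: law_indep indep bullets_ident _ k A B. Qed.

Lemma measurable_event (A : set Om) : measurable A -> measurable (X @^-1` A).
Proof. exact: measurable_preimage (measurable_sample_path b). Qed.

Lemma law_bullet i (E : set S2) : measurable E -> law [set x : Om | E (x i)] = (mu \x nu)%E E.
Proof. by move=> mE; have [_ h] := b_iid; exact: (h i E mE). Qed.

Lemma measurable_bullet i (E : set S2) : measurable E -> measurable [set x : Om | E (x i)].
Proof. by move=> mE; exact: measurable_preimage (measurable_coordinate i) mE. Qed.

Lemma law_velocity i (A : set (measurableTypeR R)) : measurable A ->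
  law [set x : Om | A (velocity x i)] = mu A.
Proof.
move=> mA; have := law_bullet i (measurableX mA measurableT).
rewrite product_measure1E// [X in (_ * X)%E](probability_setT nu) mule1 => <-; congr law.
by apply/seteqP; split=> x /=; [move=> ?; split|move=> []].
Qed.

Lemma law_delay i (A : set (measurableTypeR R)) : measurable A ->
  law [set x : Om | A (delay x i)] = nu A.
Proof.
move=> mA; have := law_bullet i (measurableX measurableT mA).
rewrite product_measure1E// [X in (X * _)%E](probability_setT mu) mul1e => <-; congr law.
by apply/seteqP; split=> x /=; [move=> ?; split|move=> []].
Qed.

Lemma law_gt0_exists (I : countType) (A : set Om) (B : I -> set Om) :
  measurable A -> (forall i, measurable (B i)) ->
  {ae P, forall w, A (X w) -> exists i, B i (X w)} -> (0 < law A)%E ->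
  exists i, (0 < law (B i))%E.
Proof.
move=> mA mB; apply: (measure_gt0_exists (A := X @^-1` A) (B := fun i => X @^-1` B i)).
  exact: measurable_event.
by move=> i; exact: measurable_event.
Qed.

Lemma law_gt0_sub (A B : set Om) : measurable A -> measurable B ->
  {ae P, forall w, A (X w) -> B (X w)} -> (0 < law A)%E -> (0 < law B)%E.
Proof.
by move=> mA mB; apply: (measure_gt0_sub (A := X @^-1` A) (B := X @^-1` B)); exact: measurable_event.
Qed.

(** Bullets are peeled off one at a time by independence; measurability is carried along because
    each use of independence needs it. *)
Lemma law_word L (E : nat -> set S2) (G : set Om) : (forall i, measurable (E i)) ->
  (forall i, (i < L)%N -> (0 < (mu \x nu) (E i))%E) -> measurable G -> (0 < law G)%E ->
  measurable [set x : Om | (forall i, (i < L)%N -> E i (x i)) /\ G (skip L x)] /\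
  (0 < law [set x : Om | (forall i, (i < L)%N -> E i (x i)) /\ G (skip L x)])%E.
Proof.
elim: L E => [|L IH] E mE E0 mG G0.
  by rewrite (_ : [set x | _] = G)//; apply/seteqP; split=> x; [case|split].
have [mW W0] := IH (fun i => E i.+1) (fun i => mE i.+1) (fun i => E0 i.+1) mG G0.
set W := [set x | _] in mW W0.
have -> : [set x : Om | (forall i, (i < L.+1)%N -> E i (x i)) /\ G (skip L.+1 x)] =
    (truncate (bullet 1 1) 1 @^-1` [set x : Om | E 0 (x 0)]) `&` (skip 1 @^-1` W).
  apply/seteqP; split=> x.
    by move=> [h g]; split; [exact: (h 0)|split => // i iL; exact: (h i.+1)].
  by move=> [h0 [h g]]; split => // -[|i] // iL; exact: h.
have mE0 := measurable_bullet 0 (mE 0%N).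
have mA : measurable (truncate (bullet 1 1) 1 @^-1` [set x : Om | E 0 (x 0)]).
  exact (measurable_preimage (measurable_truncate _ _) mE0).
have mB : measurable (skip 1 @^-1` W : set Om).
  exact (measurable_preimage (measurable_skip 1) mW).
split; first exact (measurableI _ _ mA mB).
rewrite law_indepE// mule_gt0//.
by rewrite [X in (0 < X)%E](_ : _ = law [set x : Om | E 0 (x 0)])// law_bullet// E0.
Qed.

Lemma rect_gt0 (A B : set (measurableTypeR R)) : measurable A -> measurable B ->
  (0 < mu A)%E -> (0 < nu B)%E -> (0 < (mu \x nu) (A `*` B))%E.
Proof. by move=> mA mB A0 B0; rewrite product_measure1E// mule_gt0. Qed.

Lemma measurable_gt (a : R) : measurable [set x : measurableTypeR R | a < (x : R)].
Proof. by apply: measurable_lt_set; [exact: measurable_cst|exact: measurable_id]. Qed.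

Lemma measurable_ge (a : R) : measurable [set x : measurableTypeR R | a <= (x : R)].
Proof. by apply: measurable_le_set; [exact: measurable_cst|exact: measurable_id]. Qed.

Lemma measurable_lt (a : R) : measurable [set x : measurableTypeR R | (x : R) < a].
Proof. by apply: measurable_lt_set; [exact: measurable_id|exact: measurable_cst]. Qed.

Lemma measurable_le (a : R) : measurable [set x : measurableTypeR R | (x : R) <= a].
Proof. by apply: measurable_le_set; [exact: measurable_id|exact: measurable_cst]. Qed.

Lemma invr_bound_le (y : R) : 0 < y -> (Num.bound y^-1).+1%:R^-1 <= y.
Proof.
move=> y0; rewrite -[leRHS]invrK lef_pV2 ?posrE ?invr_gt0// ltW//.
by rewrite (lt_trans (archi_boundP _)) ?invr_ge0 ?ltr_nat// ltW.
Qed.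

Lemma gap_exists : exists2 e : R, 0 < e & (0 < nu [set x | (e <= x)%R])%E.
Proof.
have [||n hn] := @measure_gt0_exists _ _ _ nu nat [set x | 0 < x] (fun n => [set x | n.+1%:R^-1 <= x])
    (measurable_gt 0) (fun n => measurable_ge _) _ _.
- apply: (@filterS _ _ _ setT) => [x _ /= x0|]; last exact: filterT.
  by exists (Num.bound x^-1); exact: invr_bound_le.
- by rewrite nu_pos.
- by exists n.+1%:R^-1 => //; rewrite invr_gt0.
Qed.

Lemma positive_config_ae : {ae P, forall w, positive_config (X w)}.
Proof.
have [e e0 nue] := gap_exists.
pose B := [set x : Om | forall j, delay x j < e].
have mdlt j : measurable [set x : Om | delay x j < e].
  by apply: measurable_lt_set; [exact: measurable_delay|exact: measurable_cst].
have mB : measurable B by apply: measurable_forall => j; exact: mdlt.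
(* By independence and stationarity [law B] equals itself times the probability that a delay is less
   than [e], which is less than 1. *)
have B0 : law B = 0%E.
  have BE : B = (truncate (bullet 1 1) 1 @^-1` [set x : Om | delay x 0 < e]) `&` (skip 1 @^-1` B).
    apply/seteqP; split=> x; first by move=> h; split; [exact: (h 0%N)|move=> j; exact: (h j.+1)].
    by move=> [h0 h] [|j]; [exact: h0|exact: h].
  have := law_indepE 1 (mdlt 0%N) mB; rewrite -BE.
  rewrite [X in (_ = X * _)%E](_ : _ = nu [set x | (x < e)%R]); last first.
    by rewrite -(law_delay 0 (measurable_lt e)).
  have -> : nu [set x | (x < e)%R] = (1 - nu [set x | (e <= x)%R])%E.
    rewrite -(probability_setC nu (measurable_ge e)); congr (nu _).
    by apply/seteqP; split=> x /=; [rewrite ltNge => /negP|move=> /negP; rewrite -ltNge].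
  have f1 : law B \is a fin_num by apply: fin_num_measure; exact: measurable_event.
  have f2 : nu [set x | (e <= x)%R] \is a fin_num by apply: fin_num_measure; exact: measurable_ge.
  move: nue; rewrite -(fineK f1) -(fineK f2) lte_fin => nue.
  rewrite -EFinB -EFinM => -[h]; congr EFin.
  have : fine (nu [set x | (e <= x)%R]) * fine (law B) = 0 by lra.
  by move/eqP; rewrite mulf_eq0 gt_eqF//= => /eqP.
have vpos : {ae P, forall w, forall i, 0 < velocity (X w) i}.
  apply: ae_forall => i.
  apply: (@ae_full _ _ _ P (X @^-1` [set x : Om | 0 < velocity x i])).
    apply: measurable_event.
    by apply: measurable_lt_set; [exact: measurable_cst|exact: measurable_velocity].
  by rewrite -mu_pos; exact: (law_velocity i (measurable_gt 0)).
have dpos : {ae P, forall w, forall i, 0 < delay (X w) i}.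
  apply: ae_forall => i.
  apply: (@ae_full _ _ _ P (X @^-1` [set x : Om | 0 < delay x i])).
    apply: measurable_event.
    by apply: measurable_lt_set; [exact: measurable_cst|exact: measurable_delay].
  by rewrite -nu_pos; exact: (law_delay i (measurable_gt 0)).
have gaps : {ae P, forall w, forall k, ~ B (skip k (X w))}.
  apply: ae_forall => k; apply/(@ae_null _ _ _ P (X @^-1` (skip k @^-1` B))).
    by apply: measurable_event; exact: measurable_preimage (measurable_skip k) mB.
  by rewrite -/(law _) law_skipE.
apply: filterS3 vpos dpos gaps => w vp dp gp; split => //.
have mono i : fire_time (X w) 0 i <= fire_time (X w) 0 i.+1.
  by rewrite fire_timeS lerDl ltW.
have h n : exists i, n%:R * e <= fire_time (X w) 0 i.
  elim: n => [|n [i hi]]; first by exists 0%N; rewrite fire_time0 mul0r.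
  have [j hj] : exists j, e <= delay (X w) (i.+1 + j).
    apply: contrapT => nj; apply: (gp i.+1) => j; rewrite ltNge; apply/negP => hj.
    by apply: nj; exists j.
  exists (i.+1 + j)%N; rewrite addSn fire_timeS -natr1 mulrDl mul1r lerD//.
  apply: (le_trans hi); elim: j {hj} => [|j IH]; first by rewrite addn0.
  by rewrite addnS (le_trans IH).
move=> t; have [i hi] := h (Num.bound (`|t| / e)); exists i; apply: lt_le_trans hi.
by rewrite (le_lt_trans (ler_norm _))// -ltr_pdivrMr// archi_boundP// divr_ge0// ltW.
Qed.

End Bullets.

(** * Potential survivors as measurable events *)

Section PotentialSurvivors.
Variable R : realType.

Local Notation S2 := (measurableTypeR R * measurableTypeR R)%type.
Local Notation Om := (seq_space S2).
Implicit Types (x g : Om) (v : R).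

(** Regularity, which holds almost surely, is built in because survival is shown measurable only
    together with it. *)
Definition last_survives_above v n : set Om := [set x |
  (regular_config x /\ survivor x (bullets_between 0 n) n) /\ v < velocity x n].

Definition infinitely_many_above v : set Om :=
  [set x | forall N, exists n, (N <= n)%N /\ last_survives_above v n x].

Lemma measurable_velocity_gt v n : measurable [set x : Om | v < velocity x n].
Proof. by apply: measurable_lt_set; [exact: measurable_cst|exact: measurable_velocity]. Qed.

Lemma measurable_velocity_le v n : measurable [set x : Om | velocity x n <= v].
Proof. by apply: measurable_le_set; [exact: measurable_velocity|exact: measurable_cst]. Qed.

Lemma measurable_velocity_ge v n : measurable [set x : Om | v <= velocity x n].
Proof. by apply: measurable_le_set; [exact: measurable_cst|exact: measurable_velocity]. Qed.

Lemma measurable_last_survives_above v n : measurable (last_survives_above v n : set Om).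
Proof. by apply: measurable_conj; [exact: measurable_survivor|exact: measurable_velocity_gt]. Qed.

Lemma measurable_infinitely_many_above v : measurable (infinitely_many_above v : set Om).
Proof.
apply: measurable_forall => N; apply: measurable_exists => n.
by apply: measurable_conj; [exact: measurable_Prop|exact: measurable_last_survives_above].
Qed.

Lemma last_survives_aboveP v n x : positive_config x -> last_survives_above v n x <->
  last_survives (velocity x) (fire_time x 0) 0 n /\ v < velocity x n.
Proof.
by move=> px; split=> [[[_ s] vn]|[s vn]]; split => //; split => //; exact: positive_regular.
Qed.

Lemma last_survives_above_truncate v n x : positive_config x ->
  last_survives_above v n (truncate (bullet 1 1) n.+1 x) <-> last_survives_above v n x.
Proof.
move=> px; have E : velocity (truncate (bullet 1 1) n.+1 x) n = velocity x n.
  by rewrite /velocity /truncate ltnSn.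
rewrite /last_survives_above /= E; split=> -[[_ s] vn]; split => //; split.
- exact: positive_regular.
- exact/(survivor_truncate _ px (ltnSn n)).
- exact/positive_regular/positive_truncate.
- exact/(survivor_truncate _ px (ltnSn n)).
Qed.

Lemma not_infinitely_many_above v m x : positive_config x ->
  ~ infinitely_many_above v (skip m x) ->
  finite_set [set n | last_survives (velocity x) (fire_time x 0) m n /\ v < velocity x n].
Proof.
move=> px ni; have [N hN] : exists N, forall n, (N <= n)%N -> ~ last_survives_above v n (skip m x).
  apply: contrapT => nN; apply: ni => N; apply: contrapT => nn; apply: nN.
  by exists N => n Nn h; apply: nn; exists n.
apply: (@bounded_finite_nat _ (m + N)) => n [sn vn]; rewrite ltnNge; apply/negP => mNn.
have mn : (m <= n)%N by rewrite (leq_trans _ mNn)// leq_addr.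
apply: (hN (n - m)%N); first by rewrite leq_subRL.
apply/last_survives_aboveP; first exact: positive_shift.
by split; [apply/(last_survives_shift _ _ px); rewrite subnKC|rewrite /velocity /skip subnKC].
Qed.

Lemma finite_not_infinitely_many_above v m x : positive_config x ->
  finite_set [set n | last_survives (velocity x) (fire_time x 0) m n /\ v < velocity x n] ->
  ~ infinitely_many_above v (skip m x).
Proof.
move=> px /finite_nat_bounded[N hN] /(_ N)[n [Nn /last_survives_aboveP h]].
have [s vn] := h (positive_shift m px).
have := hN (m + n)%N (conj ((last_survives_shift m n px).1 s) vn); lia.
Qed.

Lemma PS_aboveE v x : positive_config x -> PS_above x v =
  [set n | last_survives (velocity x) (fire_time x 0) 0 n /\ v < velocity x n].
Proof.
move=> px; have rx := positive_regular px.
by apply/seteqP; split=> n [/= /(survivesP _ _ rx) s vn].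
Qed.

End PotentialSurvivors.

(** * Fast speeds *)

Section FastSpeeds.
Context {R : realType} {d : measure_display} {T : measurableType d} (P : probability T R)
  (mu nu : probability (measurableTypeR R) R)
  (b : nat -> {RV P >-> (measurableTypeR R * measurableTypeR R)%type}).
Hypotheses (mu_pos : mu [set x | 0 < x] = 1%E) (nu_pos : nu [set x | 0 < x] = 1%E).
Hypothesis b_iid : iid_bullets mu nu b.

Local Notation S2 := (measurableTypeR R * measurableTypeR R)%type.
Local Notation Om := (seq_space S2).
Local Notation X := (sample_path b).
Local Notation law := (path_law b).

Let pos_ae := positive_config_ae mu_pos nu_pos b_iid.

(** [theta] is an outer probability; off the null set of non-positive configurations, the survival
    event is the preimage under [skip 1] of the measurable set [escape v]. *)
Lemma slow_escape v : 0 <= v -> slow b v -> law (escape v) = 0%E.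
Proof.
move=> v0 sl; rewrite -(law_skipE b_iid 1 (measurable_escape v)).
have [N [mN N0 pN]] := pos_ae.
have mA : measurable (X @^-1` (skip 1 @^-1` escape v)).
  by apply: measurable_event; exact: measurable_preimage (measurable_skip 1) (measurable_escape v).
apply/(@ae_null _ _ _ P) => //.
have mAN : measurable (X @^-1` (skip 1 @^-1` escape v) `\` N) by exact: measurableD.
have : P (X @^-1` (skip 1 @^-1` escape v) `\` N) = 0%E.
  apply/eqP; rewrite eq_le measure_ge0 andbT -(measurable_mu_extE P mAN) -[leRHS]sl.
  apply: le_mu_ext => w [ew nw]; apply/(survives_with_first_speed v0) => //.
  by apply: contrapT => np; apply: nw; exact: pN.
move=> /(ae_null P mAN) h; have /(ae_null P mN) nN := N0.
by apply: filterS2 h nN => w nAN nw Aw; exact: nAN.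
Qed.

Lemma fast_escape v : 0 <= v -> fast b v -> (0 < law (escape v))%E.
Proof.
move=> v0; rewrite -(law_skipE b_iid 1 (measurable_escape v)) => fv.
have [N [mN N0 pN]] := pos_ae.
have mA : measurable (X @^-1` (skip 1 @^-1` escape v)).
  by apply: measurable_event; exact: measurable_preimage (measurable_skip 1) (measurable_escape v).
apply: (lt_le_trans fv); apply: (@le_trans _ _ (P (X @^-1` (skip 1 @^-1` escape v) `|` N))).
  rewrite -(measurable_mu_extE P); last exact: measurableU.
  apply: le_mu_ext => w /= sw.
  have [pw|np] := pselect (positive_config (X w)); last by right; exact: pN.
  by left; apply/(survives_with_first_speed v0 pw).
by apply: (le_trans (measureU2 _ _ _)) => //; rewrite [X in (_ + X)%E]N0 adde0.
Qed.

Lemma fast_finitely_many v : 0 <= v -> (0 < law (escape v))%E ->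
  law (infinitely_many_above v) = 0%E.
Proof.
move=> v0 e0; have [N [mN N0 pN]] := pos_ae.
have posN w : ~ N w -> positive_config (X w).
  by move=> nw; apply: contrapT => np; apply: nw; exact: pN.
(* Truncation makes the dependence on [b_0, ..., b_k] explicit, as [law_indepE] requires. *)
pose F k : set Om := truncate (bullet 1 1) k.+1 @^-1` last_survives_above v k.
pose H k : set Om := F k `&` (skip k.+1 @^-1` escape v).
have mE := measurable_escape v.
have mF k : measurable (F k : set Om).
  exact (measurable_preimage (measurable_truncate _ _) (measurable_last_survives_above v k)).
have mS k : measurable (skip k.+1 @^-1` escape v : set Om).
  exact (measurable_preimage (measurable_skip _) mE).
have mXF k : measurable (X @^-1` F k) by exact: measurable_event.
have mH k : measurable (X @^-1` H k) by apply: measurable_event; exact (measurableI _ _ (mF k) (mS k)).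
(* Removing the null set makes these events disjoint everywhere and not just almost surely, so their
   probabilities sum to at most 1. *)
pose A k := X @^-1` H k `\` N.
have mA k : measurable (A k) by exact: measurableD.
have PA k : P (A k) = (law (F k) * law (escape v))%E.
  rewrite -(law_indepE b_iid k.+1 (measurable_last_survives_above v k) mE) /A measureD//.
    rewrite [Z in (_ - Z)%E](_ : _ = 0%E) ?sube0//.
    apply: (@subset_measure0 _ _ _ P _ N) => //.
    exact (measurableI _ _ (mH k) mN).
  by rewrite ltey_eq fin_num_measure.
have tA : trivIset setT A.
  apply/trivIsetP => i j _ _ ij; apply/seteqP; split => // w [[[Fi Si] nw] [[Fj Sj] _]].
  have pw := posN _ nw; have rw := positive_regular pw.
  have /(last_survives_aboveP _ _ pw)[si vi] := (last_survives_above_truncate _ _ pw).1 Fi.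
  have /(last_survives_aboveP _ _ pw)[sj vj] := (last_survives_above_truncate _ _ pw).1 Fj.
  have hi := (escape_shift _ v0 pw).1 Si; have hj := (escape_shift _ v0 pw).1 Sj.
  move: ij; rewrite neq_ltn => /orP[ij|ji].
    exact: (unhit_last_survives_unique rw v0 ij si vi hi sj vj hj).
  exact: (unhit_last_survives_unique rw v0 ji sj vj hj si vi hi).
have ef : law (escape v) \is a fin_num by apply: fin_num_measure; exact: measurable_event.
pose c := fine (law (escape v)).
have c0 : 0 < c by rewrite fine_gt0// e0 ltey_eq ef.
have PF k : P (X @^-1` F k) = ((c^-1)%:E * P (A k))%E.
  rewrite PA -(fineK ef) -/c muleC -muleA -EFinM mulfV ?mule1//; exact: lt0r_neq0.
have lim0 : P (lim_sup_set (fun k => X @^-1` F k)) = 0%E.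
  apply: lim_sup_set_cvg0 => //.
  rewrite (_ : (\sum_(n <oo) _)%E = (\sum_(n <oo) (c^-1)%:E * P (A n))%E); last first.
    by apply: eq_eseriesr => k _; exact: PF.
  rewrite nneseriesZl; last by move=> k _; exact: measure_ge0.
  have <- : P (\bigcup_k A k) = (\sum_(k <oo) P (A k))%E by rewrite measure_semi_bigcup//; exact: bigcupT_measurable.
  apply: (@le_lt_trans _ _ ((c^-1)%:E * 1)%E); last by rewrite mule1 ltry.
  apply: lee_wpmul2l; first by rewrite lee_fin invr_ge0 ltW.
  by apply: probability_le1; exact: bigcupT_measurable.
apply/(@ae_null _ _ _ P); first by apply: measurable_event; exact: measurable_infinitely_many_above.
have mL : measurable (lim_sup_set (fun k => X @^-1` F k)).
  by apply: bigcapT_measurable => n; apply: bigcup_measurable => k _.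
have /(ae_null P mL) := lim0; apply: filterS2 pos_ae => w pw nl iw; apply: nl => n _.
have [k [nk h]] := iw n; exists k => //.
exact/(last_survives_above_truncate _ _ pw).
Qed.

End FastSpeeds.

(** * Slow speeds *)

Section Prefixes.
Variable R : realType.

Local Notation S2 := (measurableTypeR R * measurableTypeR R)%type.
Local Notation Om := (seq_space S2).
Implicit Types (x g : Om).

Lemma fire_time_truncate a k i x : (i < k)%N -> fire_time (truncate a k x) 0 i = fire_time x 0 i.
Proof.
move=> ik; rewrite /fire_time; apply: eq_big_nat => l /andP[_ li].
by rewrite /delay /truncate (leq_ltn_trans _ ik).
Qed.

Lemma fire_time_ge (e : R) k M x : positive_config x ->
  (forall i, (i < M)%N -> e <= delay x (k.+1 + i)) -> M%:R * e <= fire_time x 0 (k + M)%N.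
Proof.
move=> px; elim: M => [|M IH] h.
  rewrite mul0r addn0 -(fire_time0 x).
  exact: (regular_le (positive_regular px) (leq0n k)).
rewrite addnS fire_timeS -natr1 mulrDl mul1r lerD//.
  by apply: IH => i iM; apply: h; exact: ltnW.
by have := h M (ltnSn M); rewrite addSn.
Qed.

(** Once all crossings of these finitely many lines are past, faster lines are ahead. An integer [S]
    ranges over a countable set, which allows fixing it with positive probability. *)
Lemma crossing_bound N x : exists S : nat, forall i j, (i < N)%N -> (j < N)%N ->
  velocity x i < velocity x j ->
  pos (velocity x) (fire_time x 0) i S%:R < pos (velocity x) (fire_time x 0) j S%:R.
Proof.
pose m i j := meeting_time (velocity x) (fire_time x 0) i j.
pose B : R := \sum_(p : 'I_N * 'I_N) `|m p.1 p.2|.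
have B0 : 0 <= B by apply: sumr_ge0.
exists (Num.bound B) => i j iN jN vij.
have mB : m i j < (Num.bound B)%:R.
  apply: le_lt_trans (archi_boundP B0); rewrite (le_trans (ler_norm _))//.
  by rewrite /B (bigD1 (Ordinal iN, Ordinal jN))//= lerDl sumr_ge0.
by move: mB; rewrite /m /meeting_time ltr_pdivrMr ?subr_gt0// /pos; lra.
Qed.

Definition no_survivor n : set Om := [set x | forall i, (i <= n)%N ->
  ~ (regular_config x /\ survivor x (bullets_between 0 n) i)].

(** [u] and [S] are deterministic bounds for the smallest velocity and the last crossing time, so
    that the bullets fired next can be prescribed independently of the first ones. *)
Definition first_bullets_perish n (u S : R) : set Om := [set x |
  [/\ no_survivor n x, forall i, (i < n.+1)%N -> u <= velocity x i &
      forall i j, (i < n.+1)%N -> (j < n.+1)%N -> velocity x i < velocity x j ->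
      pos (velocity x) (fire_time x 0) i S < pos (velocity x) (fire_time x 0) j S]].

Lemma first_bullets_perish_truncate n u S x : positive_config x ->
  first_bullets_perish n u S (truncate (bullet 1 1) n.+1 x) <-> first_bullets_perish n u S x.
Proof.
move=> px; set y := truncate _ _ _.
have vE i : (i < n.+1)%N -> velocity y i = velocity x i.
  by move=> iN; rewrite /velocity /y /truncate iN.
have pE i s : (i < n.+1)%N ->
    pos (velocity y) (fire_time y 0) i s = pos (velocity x) (fire_time x 0) i s.
  by move=> iN; rewrite /pos vE// fire_time_truncate.
have sE i : regular_config y /\ survivor y (bullets_between 0 n) i <->
            regular_config x /\ survivor x (bullets_between 0 n) i.
  rewrite (survivor_truncate _ px (ltnSn n)).
  split=> -[_ s]; split => //; first exact: positive_regular.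
  exact/positive_regular/positive_truncate.
split=> -[ns vu ps]; split.
- by move=> i iN /sE; exact: ns.
- by move=> i iN; rewrite -vE//; exact: vu.
- by move=> i j iN jN; rewrite -!vE// -!pE//; exact: ps.
- by move=> i iN /sE; exact: ns.
- by move=> i iN; rewrite vE//; exact: vu.
- by move=> i j iN jN; rewrite !vE// !pE//; exact: ps.
Qed.

(* An odd number of bullets cannot annihilate pairwise; slower bullets fired
   next leave the resulting triple collision undisturbed. *)
Lemma forced_triple_collision n M (u S e : R) x : ~~ odd n -> positive_config x ->
  first_bullets_perish n u S x -> S < M%:R * e ->
  (forall i, (i < M)%N -> velocity x (n.+1 + i) <= u /\ e <= delay x (n.+1 + i)) ->
  ~ no_triple_collision x 0 (bullets_from 0).
Proof.
move=> on px [ns vu ps] SM h; have rx := positive_regular px.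
have SM' : S < fire_time x 0 (n + M)%N.
  by apply: (lt_le_trans SM); apply: fire_time_ge => // i iM; have [] := h i iM.
move=> /(_ _ (evP rx (bullets_from 0))); apply.
apply: contrapT => nt; move/negP: on; apply; apply: (all_perish_even rx).
  move=> i si; have /andP[_ iN] := si.1; apply: (ns i iN); split => //.
(* At [S] the faster lines are ahead, so every collision among the first bullets is past. *)
have early t i j : coll (velocity x) (fire_time x 0)
    (ev (velocity x) (fire_time x 0) (bullets_between 0 n)) t i j -> t < S.
  wlog ij : i j / (i < j)%N => [H c|c].
    have [nij _ _ _] := c; move: nij; rewrite neq_ltn => /orP[ij|ji]; first exact: H c.
    exact: H (coll_sym c).
  have [_ ai aj _] := c.
  have /andP[_ iN] := evol_mem (evP rx _) ai.
  have /andP[_ jN] := evol_mem (evP rx _) aj.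
  by apply: (coll_before rx (evP rx _) c ij) => vij; apply: ps.
have ext t i j : coll (velocity x) (fire_time x 0)
    (ev (velocity x) (fire_time x 0) (bullets_between 0 n)) t i j ->
    coll (velocity x) (fire_time x 0) (ev (velocity x) (fire_time x 0) (bullets_from 0)) t i j.
  move=> c; apply: (@triple_extends _ _ _ rx n M) => //; last first.
    exact: lt_trans (early _ _ _ c) SM'.
  move=> k l kn /andP[nl lM].
  have [] := h (l - n.+1)%N; first by lia.
  by rewrite subnKC// => lu _; apply: (le_trans lu); apply: vu.
move=> t i j k c c'; apply/eqP/negP => /negP jk; apply: nt.
by exists t, i, j, k; split => //; exact: ext.
Qed.

(** Bullets 1 to [J.*2] form the pairs, odd ones slow and even ones fast, and [g] follows them.
    Their delays provide the lead [D] with which speed [v] escapes [g]; bullet 0 gives way to the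
    bullet of speed [v]. *)
Lemma pairs_escape J N (v w e D : R) x : 0 <= v -> v < w -> 0 < D -> positive_config x ->
  (forall i, (i < J.*2.+1)%N -> (if odd i then velocity x i <= v else w <= velocity x i) /\
     e <= delay x i) ->
  D <= J.*2%:R * e ->
  escape v (reset_gap D (skip J.*2.+1 x)) ->
  (forall n, (N <= n)%N -> ~ last_survives_above v n (skip J.*2.+1 x)) ->
  (forall i, (i < N)%N -> velocity (skip J.*2.+1 x) i <= w) ->
  escape v (skip 1 x).
Proof.
move=> v0 vw D0 px hE DJ.
set g := skip _ x; have pg : positive_config g by exact: positive_shift.
have rx := positive_regular px; have rg := positive_regular pg.
move=> /(escape_reset_gap v0 D0 pg) nD nN wN.
apply/(escape_shift 0 v0 px); rewrite fire_time0.
have DT : D <= fire_time x 0 J.*2.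
  apply: (le_trans DJ); rewrite -[J.*2 in leRHS]add0n; apply: fire_time_ge => // i iJ.
  by have [] := hE i.+1; rewrite ?add1n.
(* The first hitter in [g] would be a potential survivor faster than [w], hence than [v], so of
   index below [N]; but those bullets have speed at most [w]. *)
have nw : ~ hits (velocity g) (fire_time g 0) (bullets_from 0) (- delay g 0) w.
  have w0 : 0 <= w by rewrite ltW// (le_lt_trans v0).
  move=> /(hits_first rg w0)[j _|j _|s [j [aj _ sj vj]]].
  - have := regular_le rg (leq0n j); rewrite fire_time0.
    by have [_ /(_ 0%N) + _] := pg; lra.
  - by have [+ _ _] := pg; apply.
  have [Nj|jN] := leqP N j; last by have := wN j jN; lra.
  apply: (nN j Nj); apply/last_survives_aboveP => //.
  split; last exact: lt_trans vj.
  by rewrite /last_survives -upto_from.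
have E : fire_time x 0 J.*2.+1 = fire_time x 0 J.*2 + delay g 0.
  by rewrite fire_timeS /g /delay /skip addn0.
have [] := @pairs_not_hits _ _ _ rx J 0 0 v w.
- by rewrite fire_time0.
- by [].
- move=> i iJ; rewrite add0n; split.
    have [|+ _] := hE (i.*2).+1; first by rewrite ltnS ltn_double.
    by rewrite /= odd_double.
  have [|+ _] := hE (i.*2).+2; first by rewrite ltnS -doubleS leq_double.
  by rewrite /= odd_double.
- rewrite add0n => h; apply: nw; have := (hits_shift_config _ _ _ px).2 h.
  by rewrite -/g E opprD addrA subrr sub0r.
- rewrite add0n => h; apply: nD.
  have h' : hits (velocity x) (fire_time x 0) (bullets_from J.*2.+1) (fire_time x 0 J.*2.+1 - D) v.
    apply: (hits_mono rx _ _ _ _ h) => //.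
      by have [_ /(_ 0%N) + _] := pg; lra.
    by move=> j Jj; have := regular_le rx Jj; lra.
  have := (hits_shift_config _ _ _ px).2 h'.
  by rewrite -/g addrAC subrr sub0r.
- by move=> _ nh.
Qed.

End Prefixes.

Section SlowSpeeds.
Context {R : realType} {d : measure_display} {T : measurableType d} (P : probability T R)
  (mu nu : probability (measurableTypeR R) R)
  (b : nat -> {RV P >-> (measurableTypeR R * measurableTypeR R)%type}).
Hypotheses (mu_pos : mu [set x | 0 < x] = 1%E) (nu_pos : nu [set x | 0 < x] = 1%E).
Hypothesis b_iid : iid_bullets mu nu b.

Local Notation S2 := (measurableTypeR R * measurableTypeR R)%type.
Local Notation Om := (seq_space S2).
Local Notation X := (sample_path b).
Local Notation law := (path_law b).

Implicit Types (u v : R) (x : Om).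

Let pos_ae := positive_config_ae mu_pos nu_pos b_iid.

Lemma law_ge0 (A : set Om) : measurable A -> (0 <= law A)%E.
Proof. by move=> mA; apply: measure_ge0; exact: measurable_event. Qed.

Lemma law_null (A : set Om) : measurable A -> law A = 0%E <-> {ae P, forall w, ~ A (X w)}.
Proof. by move=> mA; apply: (ae_null P); exact: measurable_event. Qed.

Lemma law_neq0 (A : set Om) : measurable A -> law A <> 0%E -> (0 < law A)%E.
Proof. by move=> mA /eqP A0; rewrite lt_neqAle eq_sym A0 law_ge0. Qed.

Lemma escape_le u v x : 0 <= u -> u <= v -> positive_config x -> escape u x -> escape v x.
Proof.
move=> u0 uv px; rewrite !escapeP// ?(le_trans u0)// => nh h; apply: nh.
apply: (hits_mono (positive_regular px) _ _ _ _ h) => // j _.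
have := regular_le (positive_regular px) (leq0n j); rewrite fire_time0.
by have [_ /(_ 0%N) + _] := px; lra.
Qed.

Lemma law_escape_le u v : 0 <= u -> u <= v -> (0 < law (escape u))%E -> (0 < law (escape v))%E.
Proof.
move=> u0 uv; apply: law_gt0_sub; [exact: measurable_escape..|].
by apply: filterS pos_ae => w pw; exact: escape_le.
Qed.

Lemma infinitely_many_above_le u v x : u <= v ->
  infinitely_many_above v x -> infinitely_many_above u x.
Proof.
move=> uv h N; have [n [Nn [s vn]]] := h N.
by exists n; split => //; split => //; exact: le_lt_trans vn.
Qed.

(* A bullet that is never hit from behind has a fast speed; since that speed is
   random, monotonicity in the speed reduces to the countably many rational
   speeds and the infimum of the fast speeds. *)
Lemma unhit_finitely_many : {ae P, forall w, forall i,
  escape (velocity (X w) i) (skip i.+1 (X w)) ->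
  ~ infinitely_many_above (velocity (X w) i) (skip i.+1 (X w))}.
Proof.
pose fast_speed := [set u : R | 0 <= u /\ (0 < law (escape u))%E].
pose D (o : option rat) : R := if o is Some q then ratr q else inf fast_speed.
have dich (o : option rat) : {ae P, forall w, forall i, 0 <= D o ->
    ((0 < law (escape (D o)))%E -> ~ infinitely_many_above (D o) (skip i.+1 (X w))) /\
    (~ (0 < law (escape (D o)))%E -> ~ escape (D o) (skip i.+1 (X w)))}.
  apply: ae_forall => i; have [D0|D0] := leP 0 (D o); last first.
    by apply: filterS pos_ae => w _.
  have mS (A : set Om) : measurable A -> measurable (skip i.+1 @^-1` A : set Om).
    exact: measurable_preimage (measurable_skip _).
  have [f|nf] := pselect (0 < law (escape (D o)))%E.
    have m := measurable_infinitely_many_above (D o).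
    have /(law_null (mS _ m)) : law (skip i.+1 @^-1` infinitely_many_above (D o)) = 0%E.
      rewrite (law_skipE b_iid)//; exact: (fast_finitely_many mu_pos nu_pos b_iid D0 f).
    by apply: filterS => w h _; split => [_|/(_ f)].
  have m := measurable_escape (D o).
  have /(law_null (mS _ m)) : law (skip i.+1 @^-1` escape (D o)) = 0%E.
    by rewrite (law_skipE b_iid)//; apply: contrapT => /(law_neq0 m).
  by apply: filterS => w h _; split => [/nf|_].
apply: filterS2 pos_ae (ae_forall dich) => w px h i; set x := velocity (X w) i => ex ix.
have x0 : 0 < x by have [+ _ _] := px; apply.
have ps := positive_shift i.+1 px.
(* Suppose speed [x] escapes and yet has infinitely many potential survivors above it. Then no
   tested speed up to [x] is fast, while every tested speed from [x] on is; so the infimum is [x],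
   which would be both. *)
have below o : 0 <= D o -> D o <= x -> ~ (0 < law (escape (D o)))%E.
  move=> D0 Dx f; have [h1 _] := h o i D0; apply: (h1 f).
  exact: infinitely_many_above_le ix.
have above o : x <= D o -> (0 < law (escape (D o)))%E.
  move=> xD; apply: contrapT => nf.
  have [_ h2] := h o i (le_trans (ltW x0) xD).
  by apply: (h2 nf); apply: escape_le ex => //; exact: ltW.
have rat_above q : x <= ratr q -> fast_speed (ratr q).
  by move=> xq; split; [exact: le_trans (ltW x0) xq|exact: (above (Some q))].
have lb u : fast_speed u -> x <= u.
  move=> [u0 fu]; rewrite leNgt; apply/negP => ux.
  have [q] := rat_in_itvoo ux; rewrite in_itv/= => /andP[uq qx].
  apply: (below (Some q)); rewrite /= ?(ltW qx)// ?(le_trans u0 (ltW uq))//.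
  exact: (law_escape_le u0 (ltW uq) fu).
have ne : fast_speed !=set0.
  have [q] := rat_in_itvoo (ltr_pwDr ltr01 (lexx x)); rewrite in_itv/= => /andP[xq _].
  by exists (ratr q); apply: rat_above; exact: ltW.
have infE : inf fast_speed = x.
  apply/eqP; rewrite eq_le; apply/andP; split; last exact: lb_le_inf.
  rewrite leNgt; apply/negP => xi.
  have [q] := rat_in_itvoo xi; rewrite in_itv/= => /andP[xq qi].
  have : inf fast_speed <= ratr q.
    by apply: inf_lbound; [exists x => u /lb|apply: rat_above; exact: ltW].
  by rewrite leNgt qi.
apply: (below None); rewrite /= ?infE ?(ltW x0)//.
by have := above None; rewrite /= infE; exact.
Qed.

Lemma reduction_ae v : {ae P, forall w, ~ infinitely_many_above v (X w) -> exists m,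
  ~ infinitely_many_above v (skip m (X w)) /\
  forall i, survivor (skip m (X w)) (bullets_from 0) i -> velocity (skip m (X w)) i <= v}.
Proof.
apply: filterS2 pos_ae unhit_finitely_many => w px h ni; have rx := positive_regular px.
have ni0 : ~ infinitely_many_above v (skip 0 (X w)) by [].
have [|m [fm sm]] := last_survivor_reduction rx (not_infinitely_many_above px ni0).
- move=> i nh; apply: (not_infinitely_many_above px); apply: h.
  by apply/(escape_shift _ _ px); [case: px => /(_ i)/ltW|].
exists m; split; first exact: finite_not_infinitely_many_above.
by move=> i /(survivor_shift _ _ px); exact: sm.
Qed.

(** The levels of [measure_coinitial] bound almost every velocity from below, and each has positive
    mass at or below it, so that further bullets may be required to be no faster than [u]. *)
Lemma velocities_bounded_below (G : set Om) N : measurable G -> (0 < law G)%E ->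
  exists u, (0 < mu [set x | (x <= u)%R])%E /\
  (0 < law (G `&` [set x | forall i, (i < N)%N -> (u <= velocity x i)%R]))%E.
Proof.
move=> mG G0; have [s [s0 sn]] := measure_coinitial (probability_setT mu).
have mB (u : R) : measurable [set x : Om | forall i, (i < N)%N -> u <= velocity x i].
  apply: measurable_forall => i; apply: measurable_imply; first exact: measurable_Prop.
  exact: measurable_velocity_ge.
have cov : {ae P, forall w, forall i, exists k, s k <= velocity (X w) i}.
  apply: ae_forall => i.
  have mC : measurable (~` [set y : measurableTypeR R | exists k, s k <= (y : R)]).
    by apply: measurableC; apply: measurable_exists => k; exact: measurable_ge.
  have := law_velocity b_iid i mC; rewrite sn => /law_null h.
  apply: filterS (h _) => [w /= /contrapT//|].
  exact (measurable_preimage (@measurable_velocity R i) mC).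
have [k hk] : exists k, (0 < law (G `&` [set x | forall i, (i < N)%N -> (s k <= velocity x i)%R]))%E.
  apply: (law_gt0_exists mG _ _ G0) => [k|]; first exact (measurableI _ _ mG (mB _)).
  apply: filterS cov => w cw Gw.
  suff [k hk] : exists k, forall i, (i < N)%N -> s k <= velocity (X w) i by exists k.
  elim: N {mB} => [|N [k hk]]; first by exists 0%N.
  have [l hl] := cw N; have [kl|lk] := leP (s k) (s l).
    exists k => i; rewrite ltnS leq_eqVlt => /predU1P[->|/hk//]; exact: le_trans hl.
  exists l => i; rewrite ltnS leq_eqVlt => /predU1P[->//|/hk]; exact/le_trans/ltW.
by exists (s k); split; [exact: s0|exact: hk].
Qed.

Lemma velocities_bounded_above (G : set Om) N : measurable G -> (0 < law G)%E ->
  exists u, (0 < mu [set x | (u <= x)%R])%E /\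
  (0 < law (G `&` [set x | forall i, (i < N)%N -> (velocity x i <= u)%R]))%E.
Proof.
move=> mG G0; have [s [s0 sn]] := measure_cofinal (probability_setT mu).
have mB (u : R) : measurable [set x : Om | forall i, (i < N)%N -> velocity x i <= u].
  apply: measurable_forall => i; apply: measurable_imply; first exact: measurable_Prop.
  exact: measurable_velocity_le.
have cov : {ae P, forall w, forall i, exists k, velocity (X w) i <= s k}.
  apply: ae_forall => i.
  have mC : measurable (~` [set y : measurableTypeR R | exists k, (y : R) <= s k]).
    by apply: measurableC; apply: measurable_exists => k; exact: measurable_le.
  have := law_velocity b_iid i mC; rewrite sn => /law_null h.
  apply: filterS (h _) => [w /= /contrapT//|].
  exact (measurable_preimage (@measurable_velocity R i) mC).
have [k hk] : exists k, (0 < law (G `&` [set x | forall i, (i < N)%N -> (velocity x i <= s k)%R]))%E.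
  apply: (law_gt0_exists mG _ _ G0) => [k|]; first exact (measurableI _ _ mG (mB _)).
  apply: filterS cov => w cw Gw.
  suff [k hk] : exists k, forall i, (i < N)%N -> velocity (X w) i <= s k by exists k.
  elim: N {mB} => [|N [k hk]]; first by exists 0%N.
  have [l hl] := cw N; have [lk|kl] := leP (s l) (s k).
    exists k => i; rewrite ltnS leq_eqVlt => /predU1P[->|/hk//]; exact: le_trans lk.
  exists l => i; rewrite ltnS leq_eqVlt => /predU1P[->//|/hk h]; exact: le_trans h (ltW kl).
by exists (s k); split; [exact: s0|exact: hk].
Qed.

Lemma measurable_not_infinitely_many v : measurable (~` infinitely_many_above v : set Om).
Proof. by apply: measurableC; exact: measurable_infinitely_many_above. Qed.

Lemma measurable_skip_preimage k (A : set Om) : measurable A -> measurable (skip k @^-1` A : set Om).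
Proof. exact: measurable_preimage (measurable_skip k). Qed.

Lemma velocity_above_ae v : mu [set x | x <= v] = 0%E ->
  {ae P, forall w, forall i, v < velocity (X w) i}.
Proof.
move=> muv; apply: ae_forall => i; have := law_velocity b_iid i (measurable_le v).
rewrite muv => /law_null h; apply: filterS (h _) => [w /negP|]; first by rewrite -ltNge.
exact: measurable_velocity_le.
Qed.

Lemma slow_infinite_all_above v : valid b -> mu [set x | x <= v] = 0%E ->
  law (~` infinitely_many_above v) = 0%E.
Proof.
move=> b_valid muv; have vel := velocity_above_ae muv.
apply: contrapT => /(law_neq0 (measurable_not_infinitely_many v)) W0.
(* All velocities exceed [v], so having no survivor faster than [v] means complete annihilation, and
   this for every large [n]. *)
pose F N : set Om := [set x | forall n, (N <= n)%N -> no_survivor n x].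
have mns n : measurable (no_survivor n : set Om).
  apply: measurable_forall => i; apply: measurable_imply; first exact: measurable_Prop.
  by apply: measurable_not; exact: measurable_survivor.
have mF N : measurable (F N : set Om).
  by apply: measurable_forall => n; apply: measurable_imply; [exact: measurable_Prop|exact: mns].
have [[m N] /=] : exists p : nat * nat, (0 < law (skip p.1 @^-1` F p.2))%E.
  apply: (law_gt0_exists (measurable_not_infinitely_many v) _ _ W0) => [p|].
    exact: measurable_skip_preimage.
  apply: filterS3 pos_ae vel (reduction_ae v) => w px vw red /red[m [ni sm]].
  have pm := positive_shift m px; have rm := positive_regular pm.
  have fm := @not_infinitely_many_above _ v 0 _ pm ni.
  have [N hN] := transient_finite_survivors rm fm sm.
  exists (m, N) => n Nn i iN [_ s]; have := hN n i Nn s; have := vw (m + i)%N.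
  by rewrite /velocity /skip; lra.
rewrite (law_skipE b_iid)// => F0.
have [u [u0 G0]] : exists u, (0 < mu [set x | (x <= u)%R])%E /\
    (0 < law (no_survivor N.*2 `&` [set x | forall i, (i < N.*2.+1)%N -> (u <= velocity x i)%R]))%E.
  apply: velocities_bounded_below; first exact: mns.
  apply: (law_gt0_sub (mF N) (mns _) _ F0).
  by apply: filterS pos_ae => w _; apply; rewrite -addnn leq_addr.
(* Even, so that the number [n.+1] of bullets is odd. *)
pose n := N.*2.
have mB : measurable [set x : Om | forall i, (i < n.+1)%N -> u <= velocity x i].
  apply: measurable_forall => i; apply: measurable_imply; first exact: measurable_Prop.
  exact: measurable_velocity_ge.
have mQ S : measurable (first_bullets_perish n u S : set Om).
  rewrite (_ : first_bullets_perish n u S = [set x : Om | no_survivor n x /\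
    ((forall i, (i < n.+1)%N -> u <= velocity x i) /\
    forall i j, (i < n.+1)%N -> (j < n.+1)%N -> velocity x i < velocity x j ->
      pos (velocity x) (fire_time x 0) i S < pos (velocity x) (fire_time x 0) j S)]); last first.
    by apply/seteqP; split=> x; [move=> []|move=> [? []]].
  apply: measurable_conj; first exact: mns.
  apply: measurable_conj; first exact: mB.
  apply: measurable_forall => i; apply: measurable_forall => j.
  do 2! (apply: measurable_imply; first exact: measurable_Prop).
  apply: measurable_imply; first by apply: measurable_lt_set; exact: measurable_velocity.
  apply: measurable_lt_set; apply: measurable_funM; try exact: measurable_velocity.
    by apply: measurable_funB; [exact: measurable_cst|exact: measurable_fire_time].
  by apply: measurable_funB; [exact: measurable_cst|exact: measurable_fire_time].
have [S Q0] : exists S : nat, (0 < law (first_bullets_perish n u S%:R))%E.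
  apply: (law_gt0_exists _ _ _ G0) => [|S|]; [exact (measurableI _ _ (mns n) mB)|exact: mQ|].
  by apply: filterS pos_ae => w _ [ns vu]; have [S hS] := crossing_bound n.+1 (X w); exists S.
have [e e0 nue] := gap_exists nu_pos.
pose M := (Num.bound (S%:R / e)).
have SM : S%:R < M%:R * e by rewrite -ltr_pdivrMr// archi_boundP// divr_ge0// ltW.
(* Bullets no faster than the first ones, with gaps whose total length exceeds [S]. *)
pose E (i : nat) : set S2 := [set x | (x <= u)%R] `*` [set x | (e <= x)%R].
have mE i : measurable (E i) by apply: measurableX; [exact: measurable_le|exact: measurable_ge].
have [mW W1] := law_word b_iid (L := M) mE
  (fun i _ => rect_gt0 (measurable_le u) (measurable_ge e) u0 nue) measurableT
  (eq_ind_r (fun z => 0 < z)%E lte01 (probability_setT P)).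
set W := [set x | _] in mW W1.
have := law_indepE b_iid n.+1 (mQ S%:R) mW.
set A := _ `&` _ => lawA.
have mA : measurable (A : set Om).
  exact (measurableI _ _ (measurable_preimage (measurable_truncate _ _) (mQ _))
    (measurable_preimage (measurable_skip _) mW)).
have : (0 < law A)%E.
  rewrite lawA mule_gt0//; apply: (law_gt0_sub (mQ S%:R) _ _ Q0).
    exact (measurable_preimage (measurable_truncate _ _) (mQ _)).
  by apply: filterS pos_ae => w px Qw; apply/(first_bullets_perish_truncate _ _ _ px).
rewrite (_ : law A = 0%E) ?ltxx//; apply/law_null => //.
apply: filterS2 pos_ae b_valid => w px nt [Qw [Ww _]].
apply: (@forced_triple_collision _ n M u S%:R e (X w) _ px _ SM _ nt).
- by rewrite odd_double.
- exact/(first_bullets_perish_truncate _ _ _ px).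
- by move=> i /Ww[].
Qed.

Lemma slow_infinite_some_below v : 0 <= v -> law (escape v) = 0%E ->
  (0 < mu [set x | (x <= v)%R])%E -> law (~` infinitely_many_above v) = 0%E.
Proof.
move=> v0 ev0 muv.
apply: contrapT => /(law_neq0 (measurable_not_infinitely_many v)) W0.
have mesc := measurable_escape v.
have vpos : 0 < v.
  rewrite lt_neqAle v0 andbT; apply/eqP => vz; move: muv.
  rewrite -vz (_ : [set x | _] = ~` [set x | 0 < x]).
    have := probability_setC mu (measurable_gt (0 : R)).
    by rewrite mu_pos subee// => ->; rewrite ltxx.
  by apply/seteqP; split=> x /=; [rewrite leNgt => /negP|move=> /negP; rewrite -leNgt].
(* If almost surely no bullet were faster than [v], a bullet of speed [v] would never be caught,
   contradicting [ev0]. *)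
have [w1 vw1 muw1] : exists2 w1, v < w1 & (0 < mu [set x | (w1 <= x)%R])%E.
  have [|muv0] := pselect (0 < mu [set x | (v < x)%R])%E.
    move=> muv0; have [||n hn] := @measure_gt0_exists _ _ _ mu nat [set x | v < x]
        (fun n => [set x | v + n.+1%:R^-1 <= x]) (measurable_gt v) (fun n => measurable_ge _) _ _.
    - apply: (@filterS _ _ _ setT) => [x _ /= vx|]; last exact: filterT.
      by exists (Num.bound (x - v)^-1); rewrite -lerBrDl; apply: invr_bound_le; rewrite subr_gt0.
    - exact: muv0.
    - by exists (v + n.+1%:R^-1) => //; rewrite ltrDl invr_gt0.
  exfalso; have vel : {ae P, forall w, forall i, velocity (X w) i <= v}.
    apply: ae_forall => i.
    have /law_null h : law [set x : Om | v < velocity x i] = 0%E.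
      rewrite (law_velocity b_iid i (measurable_gt v)).
      by apply/eqP; rewrite eq_le measure_ge0 andbT leNgt; apply/negP.
    apply: filterS (h _) => [w /negP|]; first by rewrite -leNgt.
    exact: measurable_velocity_gt.
  have /(law_null measurableT) : {ae P, forall w, ~ [set: Om] (X w)}.
    apply: filterS3 pos_ae vel ((law_null mesc).1 ev0) => w px vw ne _; apply: ne.
    apply/(escapeP v0 px) => /(hits_first (positive_regular px) v0)[j _|j _|s [j [_ _ _ vj]]].
    - have := regular_le (positive_regular px) (leq0n j); rewrite fire_time0.
      by have [_ /(_ 0%N) + _] := px; lra.
    - by have [+ _ _] := px; apply.
    - by have := vw j; rewrite leNgt vj.
  rewrite /path_law preimage_setT probability_setT => /eqP; by rewrite onee_eq0.
(* [D.+1] is a sufficient lead and [N] bounds the indices of the potential survivors faster than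
   [v]; both are random and get fixed by countable exhaustion. *)
pose G D N : set Om := [set g | escape v (reset_gap D.+1%:R g) /\
  forall n, (N <= n)%N -> ~ last_survives_above v n g].
have mG D N : measurable (G D N : set Om).
  apply: measurable_conj.
    exact (measurable_preimage (@measurable_reset_gap R _) mesc).
  apply: measurable_forall => n; apply: measurable_imply; first exact: measurable_Prop.
  by apply: measurable_not; exact: measurable_last_survives_above.
have [[[m D] N] /=] : exists p : nat * nat * nat, (0 < law (skip p.1.1 @^-1` G p.1.2 p.2))%E.
  apply: (law_gt0_exists (measurable_not_infinitely_many v) _ _ W0) => [p|].
    exact: measurable_skip_preimage.
  apply: filterS2 pos_ae (reduction_ae v) => w px red /red[m [ni sm]].
  have pm := positive_shift m px; have rm := positive_regular pm.
  have fm := @not_infinitely_many_above _ v 0 _ pm ni.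
  have pm0 : 0 < velocity (skip m (X w)) 0 by have [+ _ _] := pm; apply.
  have [D hD] := transient_not_hits rm fm sm pm0 vpos.
  have [N hN] := finite_nat_bounded fm.
  exists (m, D, N); split => /=.
    by apply/(escape_reset_gap v0 _ pm) => //; move: hD; rewrite fire_time0 sub0r.
  move=> n Nn /(last_survives_aboveP _ _ pm) h; have := hN n h; lia.
rewrite (law_skipE b_iid)// => G0.
have [w2 [muw2 G20]] := velocities_bounded_above N (mG D N) G0.
(* The larger of [w1] and [w2]: the fast bullet of a pair can have at least this speed, and the
   first [N] bullets of the process do not exceed it. *)
have [w [vw muw [w2w]]] : exists w, [/\ v < w, (0 < mu [set x | (w <= x)%R])%E & w2 <= w].
  have [w12|w21] := leP w1 w2; last by exists w1; split => //; exact: ltW.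
  by exists w2; split => //; exact: lt_le_trans w12.
set G2 := _ `&` _ in G20.
have mG2 : measurable (G2 : set Om).
  apply: measurableI; first exact: mG.
  apply: measurable_forall => i; apply: measurable_imply; first exact: measurable_Prop.
  exact: measurable_velocity_le.
have [e e0 nue] := gap_exists nu_pos.
pose J := (Num.bound (D.+1%:R / e)).
have DJ : D.+1%:R <= J.*2%:R * e.
  rewrite -ler_pdivrMr//; apply: (@le_trans _ _ J%:R).
    by rewrite ltW// archi_boundP// divr_ge0// ltW.
  by rewrite ler_nat -addnn leq_addr.
pose E (i : nat) : set S2 :=
  (if odd i then [set x | (x <= v)%R] else [set x | (w <= x)%R]) `*` [set x | (e <= x)%R].
have mE i : measurable (E i).
  by apply: measurableX; [case: ifP => _; [exact: measurable_le|exact: measurable_ge]|exact: measurable_ge].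
have E0 i : (i < J.*2.+1)%N -> (0 < (mu \x nu) (E i))%E.
  move=> _; rewrite /E; case: ifP => _; apply: rect_gt0 => //;
    by [exact: measurable_le|exact: measurable_ge].
have [mA A0] := law_word b_iid mE E0 mG2 G20.
have : (0 < law (skip 1 @^-1` escape v))%E.
  apply: (law_gt0_sub mA _ _ A0); first exact: measurable_skip_preimage.
  apply: filterS pos_ae => x px [hE [[hD hN] hw]].
  apply: (@pairs_escape _ J N v w e D.+1%:R (X x) v0 vw) => //.
    by move=> i /hE[]; case: ifP.
  by move=> i /hw h; exact: le_trans w2w.
by rewrite (law_skipE b_iid)// ev0 ltxx.
Qed.

Lemma slow_infinite v : valid b -> 0 <= v -> law (escape v) = 0%E ->
  law (~` infinitely_many_above v) = 0%E.
Proof.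
move=> b_valid v0 ev0.
have [m0|/eqP m0] := eqVneq (mu [set x | (x <= v)%R]) 0%E.
  exact: slow_infinite_all_above.
apply: slow_infinite_some_below => //.
by rewrite lt_neqAle eq_sym measure_ge0 andbT; apply/eqP.
Qed.

End SlowSpeeds.

Theorem theorem6 (R : realType) (d : measure_display) (T : measurableType d)
    (P : probability T R)
    (mu nu : probability (measurableTypeR R) R)
    (b : nat -> {RV P >-> (measurableTypeR R * measurableTypeR R)%type})
    (v : R)
    (mu_pos : mu [set x | 0 < x] = 1%E) (nu_pos : nu [set x | 0 < x] = 1%E)
    (b_iid : iid_bullets mu nu b) (b_valid : valid b) (v_ge0 : 0 <= v) :
  (slow b v -> {ae P, forall w, infinite_set (PS_above (config b w) v)}) /\
  (fast b v -> {ae P, forall w, finite_set (PS_above (config b w) v)}).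
Proof.
have pos_ae := positive_config_ae mu_pos nu_pos b_iid.
split=> [sl|fv].
- have e0 := slow_escape mu_pos nu_pos b_iid v_ge0 sl.
  have /law_null h := slow_infinite mu_pos nu_pos b_iid b_valid v_ge0 e0.
  apply: filterS2 pos_ae (h (measurable_not_infinitely_many v)) => w px iw.
  rewrite (PS_aboveE v px) => fin; apply: iw.
  exact (@finite_not_infinitely_many_above _ v 0 _ px fin).
- have /law_null h := fast_finitely_many mu_pos nu_pos b_iid v_ge0
    (fast_escape mu_pos nu_pos b_iid v_ge0 fv).
  apply: filterS2 pos_ae (h (measurable_infinitely_many_above v)) => w px iw.
  by rewrite (PS_aboveE v px); exact (@not_infinitely_many_above _ v 0 _ px iw).
Qed.
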